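(* Let $D$ be a connection on the spinor bundle $S$ of $M$ and $\mathcal A:=D-\nabla\in\Omega^1(M)\otimes\Gamma\,\mathrm{End}(S)$. Suppose $\mathcal A_X$ is homogeneous of degree $\ell$ with respect to $\Gamma\,\mathrm{End}(S)\simeq\bigoplus_k\Omega^k(M)$, for all vector fields $X$. According to the decomposition $$\Omega^1(M)\otimes\Omega^\ell(M)=\Omega^{\ell+1}(M)\oplus\Omega^{\ell-1}(M)\oplus\Omega^{(\ell,1)},$$ $\mathcal A$ may be written as $\mathcal A_X=X\rfloor F+X\wedge G+\mathcal A_0(X)$ with an $(\ell+1)$-form $F$, an $(\ell-1)$-form $G$ and $\mathcal A_0\in\Omega^{(\ell,1)}$. Then $D$ is admissible if and only if $\mathcal A_0=0$ and, for each non-vanishing one of the forms $F$ and $G$, its degree $\deg$ ($\deg=\ell+1$ for $F$, $\deg=\ell-1$ for $G$) satisfies $\Delta_1\Delta_{\deg}=-1$; the latter condition is equivalent to $\Delta_0\Delta_{\deg-1}=(-1)^{\deg}$, i.e. to $\deg\equiv 3 \bmod 4$ or $\deg\equiv 1+\Delta_0\Delta_1\bmod 4$.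
   Context: $(M,g)$ is a (pseudo-)Riemannian spin manifold with Levi-Civita connection $\nabla$ (also on the spinor bundle $S$) and Clifford multiplication $\gamma$, $\gamma(X)\gamma(Y)+\gamma(Y)\gamma(X)=-2g(X,Y)$; $\gamma_\mu=\gamma(e_\mu)$, and $\gamma_{\mu_1\cdots\mu_k}$ is the skew-symmetrization (weight one) of $\gamma_{\mu_1}\cdots\gamma_{\mu_k}$. A $k$-form $\omega$ is identified with the endomorphism $\frac1{k!}\omega_{\mu_1\ldots\mu_k}\gamma^{\mu_1\cdots\mu_k}$ of $S$; this gives $\Gamma\,\mathrm{End}(S)\simeq\bigoplus_k\Omega^k(M)$ (complex coefficients if needed), with $0\le k\le\dim M$ if $\dim M$ is even and $0\le k\le\frac12(\dim M-1)$ if $\dim M$ is odd. $\Omega^{(\ell,1)}$ denotes the sections of the irreducible complement with highest weight $e_1+e_\ell$. $C$ is a fixed charge conjugation: a non-degenerate spin-invariant bilinear form on $S$. The signs $\Delta_k\in\{\pm1\}$ are defined by $C(\phi,\gamma_{\mu_1\cdots\mu_k}\psi)=\Delta_kC(\psi,\gamma_{\mu_1\cdots\mu_k}\phi)$; one has $\Delta_k=(-1)^{k(k-1)/2}\Delta_0^{k+1}\Delta_1^k$ (this formula is used for all integers $k$). For $\Phi\in\mathrm{End}(S)$, $\Phi^C$ is defined by $C(\Phi^C\eta,\xi)=C(\eta,\Phi\xi)$, and $D^C:=\nabla-\mathcal A^C$. Set $(\hat D_Z\gamma)(X)\xi=D_Z(\gamma(X)\xi)-\gamma(\nabla_ZX)\xi-\gamma(X)D^C_Z\xi$.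 The connection $D$ is called admissible if $\hat D\gamma$ is skew symmetric, i.e. $(\hat D_X\gamma)(Y)=-(\hat D_Y\gamma)(X)$ for all vector fields $X,Y$. *)

(* Defs.v *)
From HB Require Import structures.
From mathcomp Require Export all_boot all_order all_algebra all_fingroup.
From mathcomp Require Export boolp classical_sets reals topology normedtype.
From mathcomp Require Export derive.
From mathcomp Require Export complex.
Export Order.TTheory GRing.Theory Num.Theory.
Export numFieldNormedType.Exports.

Set Implicit Arguments.
Unset Strict Implicit.
Unset Printing Implicit Defensive.

Local Open Scope classical_set_scope.
Local Open Scope ring_scope.
Local Open Scope complex_scope.

(* Total functions stand for functions on the open set [U]. Being C^(k+1)
   means being differentiable with C^k directional derivatives, which agrees
   with the definition by continuous iterated partial derivatives. *)
Fixpoint Ck (R : realType) (n k : nat) (U : set 'rV[R]_n) (f : 'rV[R]_n -> R)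
    : Prop :=
  if k is k'.+1 then
    (forall x, U x -> differentiable f x) /\
    (forall v, Ck k' U (fun x => 'D_v f x))
  else forall x, U x -> {for x, continuous f}.

Definition Cinf (R : realType) (n : nat) (U : set 'rV[R]_n)
    (f : 'rV[R]_n -> R) : Prop := forall k, Ck k U f.

(* The atlas is indexed by the points: [chart x] is a chart around [x], with
   domain [chart_dom x] and inverse [chart_inv x]; outside of the domain
   (resp. its image) the values are irrelevant. *)
Record manifold (R : realType) (n : nat) := Manifold {
  mspace :> topologicalType;
  m_hausdorff : hausdorff_space mspace;
  m_second_countable : @second_countable mspace;
  chart_dom : mspace -> set mspace;
  chart : mspace -> mspace -> 'rV[R]_n;
  chart_inv : mspace -> 'rV[R]_n -> mspace;
  chart_dom_open : forall x, open (chart_dom x);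
  chart_dom_mem : forall x, chart_dom x x;
  chart_img_open : forall x, open (chart x @` chart_dom x);
  chartK : forall x y, chart_dom x y -> chart_inv x (chart x y) = y;
  chart_cont : forall x y, chart_dom x y -> {for y, continuous (chart x)};
  chart_inv_cont : forall x p, (chart x @` chart_dom x) p ->
    {for p, continuous (chart_inv x)};
  chart_smooth : forall x y (i : 'I_n),
    Cinf (chart x @` (chart_dom x `&` chart_dom y))
         (fun p => chart y (chart_inv x p) ord0 i)
}.

Section Calculus.
Variables (R : realType) (n : nat) (M : manifold R n).

Definition smooth (U : set M) (f : M -> R) : Prop :=
  forall x, Cinf (chart x @` (U `&` chart_dom x)) (f \o chart_inv x).

Definition csmooth (U : set M) (f : M -> R[i]) : Prop :=
  smooth U (fun x => complex.Re (f x)) /\ smooth U (fun x => complex.Im (f x)).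

(* The tangent space at [x] is ['rV[R]_n], a tangent vector being identified
   with its components in the preferred chart [chart x] at its base point. *)
Definition der (x : M) (v : 'rV[R]_n) (f : M -> R) : R :=
  'D_v (f \o chart_inv x) (chart x x).

Definition cder (x : M) (v : 'rV[R]_n) (f : M -> R[i]) : R[i] :=
  (der x v (fun y => complex.Re (f y))) +i* (der x v (fun y => complex.Im (f y))).

(* [X] is a smooth vector field on [U]. Its components [X y] refer to a chart
   that varies with [y], so smoothness is that of the derivation [f |-> X f]. *)
Definition vsmooth (U : set M) (X : M -> 'rV[R]_n) : Prop :=
  forall V f, open V -> V `<=` U -> smooth V f ->
    smooth V (fun y => der y (X y) f).

(* A covariant derivative [nab x v s] of the section [s] at [x] along the
   tangent vector [v], for a K-vector bundle with fibres [V]. It is only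
   constrained on sections that are smooth near [x] and depends only on their
   germ at [x]. [sm_f], [d] are the smooth K-valued functions and their
   derivatives, [sm_s] the smooth sections. *)
Record is_connection (K : comNzRingType) (V : lmodType K)
    (iota : R -> K)
    (sm_f : set M -> (M -> K) -> Prop) (d : M -> 'rV[R]_n -> (M -> K) -> K)
    (sm_s : set M -> (M -> V) -> Prop)
    (nab : M -> 'rV[R]_n -> (M -> V) -> V) : Prop := IsConnection {
  conn_linear : forall U x s a u v, open U -> U x -> sm_s U s ->
    nab x (a *: u + v) s = iota a *: nab x u s + nab x v s;
  conn_add : forall U x v s t, open U -> U x -> sm_s U s -> sm_s U t ->
    nab x v (fun y => s y + t y) = nab x v s + nab x v t;
  conn_leibniz : forall U x v f s, open U -> U x -> sm_f U f -> sm_s U s ->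
    nab x v (fun y => f y *: s y) = d x v f *: s x + f x *: nab x v s;
  conn_germ : forall U x v s t, open U -> U x -> sm_s U s ->
    (forall y, U y -> s y = t y) -> nab x v s = nab x v t;
  conn_smooth : forall U X s, open U -> vsmooth U X -> sm_s U s ->
    sm_s U (fun y => nab y (X y) s)
}.

Definition mx_inner (G : 'M[R]_n) (u v : 'rV[R]_n) : R :=
  (u *m G *m v^T) ord0 ord0.

Record metric := Metric {
  gram : M -> 'M[R]_n;
  gram_sym : forall x, (gram x)^T = gram x;
  gram_unit : forall x, gram x \in unitmx;
  gram_smooth : forall U X Y, open U -> vsmooth U X -> vsmooth U Y ->
    smooth U (fun x => mx_inner (gram x) (X x) (Y x))
}.

Definition inner (g : metric) (x : M) : 'rV[R]_n -> 'rV[R]_n -> R :=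
  mx_inner (gram g x).

Record is_levi_civita (g : metric)
    (nab : M -> 'rV[R]_n -> (M -> 'rV[R]_n) -> 'rV[R]_n) : Prop :=
  IsLeviCivita {
  lc_conn : is_connection idfun smooth der vsmooth nab;
  lc_metric : forall U x v X Y, open U -> U x -> vsmooth U X -> vsmooth U Y ->
    der x v (fun y => inner g y (X y) (Y y)) =
    inner g x (nab x v X) (Y x) + inner g x (X x) (nab x v Y);
  lc_torsion : forall U x X Y f, open U -> U x -> vsmooth U X -> vsmooth U Y ->
    smooth U f ->
    der x (nab x (X x) Y - nab x (Y x) X) f =
    der x (X x) (fun y => der y (Y y) f) - der x (Y x) (fun y => der y (X y) f)
}.

Local Notation N := (2 ^ n./2)%N.

Definition model_gamma (Gam : 'I_n -> 'M[R[i]]_N) (v : 'rV[R]_n) : 'M[R[i]]_N :=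
  \sum_a (v ord0 a)%:C *: Gam a.

(* The Clifford representation is faithful on the spin group, which is
   therefore identified with its image: products of an even number of unit
   vectors of R^(p,q), evenly many of which have square norm -1 (in the
   definite case this is all of Spin(n); in the indefinite case it is the
   largest subgroup of Spin(p,q) that can preserve a bilinear form on
   spinors for which Clifford multiplication is (skew-)symmetric). *)
Definition is_spin (eta : 'I_n -> R) (Gam : 'I_n -> 'M[R[i]]_N)
    (T : 'M[R[i]]_N) : Prop :=
  let q (v : 'rV[R]_n) := \sum_a eta a * v ord0 a ^+ 2 in
  exists vs : seq 'rV[R]_n,
    [/\ all (fun v => (q v == 1) || (q v == -1)) vs,
        ~~ odd (size vs), ~~ odd (count (fun v => q v == -1) vs)
      & T = \prod_(v <- vs) model_gamma Gam v].

(* A spin structure on (M, g), given through its associated complex spinor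
   bundle. The fibres are ['cV_N], [triv x] is a local trivialization over the
   neighbourhood [sdom x] of [x] and [frame x] the orthonormal frame it lies
   above: in these trivializations Clifford multiplication by the frame is
   given by the constant matrices [sgamma]. That the transition function
   between two trivializations lifts the one between the corresponding frames
   follows from [clif_frame]. *)
Record spinor_bundle (g : metric) := SpinorBundle {
  eta : 'I_n -> R;
  eta_sign : forall a, eta a = 1 \/ eta a = -1;
  sgamma : 'I_n -> 'M[R[i]]_N;
  sgamma_clifford : forall a b,
    sgamma a *m sgamma b + sgamma b *m sgamma a =
    (if a == b then - (2 * eta a)%:C else 0)%:M;
  sdom : M -> set M;
  sdom_open : forall x, open (sdom x);
  sdom_mem : forall x, sdom x x;
  frame : M -> M -> 'I_n -> 'rV[R]_n;
  frame_smooth : forall x a, vsmooth (sdom x) (fun y => frame x y a);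
  frame_orthonormal : forall x y a b, sdom x y ->
    inner g y (frame x y a) (frame x y b) = if a == b then eta a else 0;
  triv : M -> M -> 'M[R[i]]_N;
  triv_unit : forall x y, sdom x y -> triv x y \in unitmx;
  triv_spin : forall x z y, sdom x y -> sdom z y ->
    is_spin eta sgamma (triv x y *m invmx (triv z y));
  triv_smooth : forall x z i j,
    csmooth (sdom x `&` sdom z) (fun y => (triv x y *m invmx (triv z y)) i j);
  clif : M -> 'rV[R]_n -> 'M[R[i]]_N;
  clif_linear : forall y a u v,
    clif y (a *: u + v) = a%:C *: clif y u + clif y v;
  clif_frame : forall x y a, sdom x y ->
    triv x y *m clif y (frame x y a) = sgamma a *m triv x y
}.

Section Spinors.
Variables (g : metric) (S : spinor_bundle g).

Definition ssmooth (U : set M) (s : M -> 'cV[R[i]]_N) : Prop :=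
  forall x i, csmooth (U `&` sdom S x) (fun y => (triv S x y *m s y) i ord0).

(* The Levi-Civita connection on spinors: in the trivialization over the frame
   e it is d + 1/4 sum_ab eta_a eta_b g(nabla e_a, e_b) gamma_a gamma_b, for
   the convention gamma_a^2 = - eta_a. *)
Definition spin_nabla (nab : M -> 'rV[R]_n -> (M -> 'rV[R]_n) -> 'rV[R]_n)
    (x : M) (v : 'rV[R]_n) (s : M -> 'cV[R[i]]_N) : 'cV[R[i]]_N :=
  invmx (triv S x x) *m
    ((\col_i cder x v (fun y => (triv S x y *m s y) i ord0)) +
     4^-1 *: \sum_a \sum_b
       (eta S a * eta S b *
        inner g x (nab x v (fun y => frame S x y a)) (frame S x x b))%:C *:
       (sgamma S a *m sgamma S b *m (triv S x x *m s x))).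

Definition spinor_connection (D : M -> 'rV[R]_n -> (M -> 'cV[R[i]]_N) ->
    'cV[R[i]]_N) : Prop :=
  is_connection (fun a : R => a%:C) csmooth cder ssmooth D.

Definition is_difference (D nabS : M -> 'rV[R]_n -> (M -> 'cV[R[i]]_N) ->
    'cV[R[i]]_N) (A : M -> 'rV[R]_n -> 'M[R[i]]_N) : Prop :=
  forall U x v s, open U -> U x -> ssmooth U s ->
    D x v s - nabS x v s = A x v *m s x.

Definition gamma_skew (x : M) (k : nat) (v : 'I_k -> 'rV[R]_n) : 'M[R[i]]_N :=
  (k`!%:R)^-1 *:
  \sum_(s : 'S_k) (-1) ^+ s *: \prod_(i < k) clif S x (v (s i)).

(* [C] is a spin-invariant non-degenerate bilinear form on the spinor module,
   carried over to the bundle by the spin trivializations. *)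
Record charge_conjugation := ChargeConjugation {
  charge_model : 'M[R[i]]_N;
  charge_unit : charge_model \in unitmx;
  charge_spin : forall T, is_spin (eta S) (sgamma S) T ->
    T^T *m charge_model *m T = charge_model;
  charge_mx : M -> 'M[R[i]]_N;
  charge_triv : forall x y, sdom S x y ->
    charge_mx y = (triv S x y)^T *m charge_model *m triv S x y
}.

Definition cform (C : charge_conjugation) (x : M) (phi psi : 'cV[R[i]]_N)
    : R[i] := (phi^T *m charge_mx C x *m psi) ord0 ord0.

Definition is_charge_signs (C : charge_conjugation) (Delta : int -> int)
    : Prop :=
  [/\ forall k, Delta k = 1 \/ Delta k = -1,
      forall (k : nat) (x : M) (m : 'I_k -> 'I_n) phi psi, (k <= n)%N ->
        let gam := gamma_skew x (fun i => frame S x x (m i)) in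
        cform C x phi (gam *m psi) =
        (Delta k%:Z)%:~R * cform C x psi (gam *m phi)
    & forall k : int, Delta k =
        (-1) ^ (k * (k - 1) %/ 2)%Z * Delta 0 ^ (k + 1) * Delta 1 ^ k].

Definition charge_adj (C : charge_conjugation) (x : M) (Phi : 'M[R[i]]_N)
    : 'M[R[i]]_N := (charge_mx C x *m Phi *m invmx (charge_mx C x))^T.

Lemma charge_mx_unit (C : charge_conjugation) x : charge_mx C x \in unitmx.
Proof.
have xx := sdom_mem S x.
by rewrite (charge_triv C xx) !unitmx_mul unitmx_tr charge_unit
  (triv_unit xx).
Qed.

Lemma charge_adjP (C : charge_conjugation) x Phi phi psi :
  cform C x (charge_adj C x Phi *m phi) psi = cform C x phi (Phi *m psi).
Proof.
rewrite /cform /charge_adj trmx_mul trmxK -!mulmxA.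
by rewrite (mulmxA (invmx _)) mulVmx ?mul1mx // charge_mx_unit.
Qed.

(* D^C = nabla - A^C *)
Definition conj_connection (C : charge_conjugation)
    (nabS : M -> 'rV[R]_n -> (M -> 'cV[R[i]]_N) -> 'cV[R[i]]_N)
    (A : M -> 'rV[R]_n -> 'M[R[i]]_N) (x : M) (v : 'rV[R]_n)
    (s : M -> 'cV[R[i]]_N) : 'cV[R[i]]_N :=
  nabS x v s - charge_adj C x (A x v) *m s x.

(* ((Dhat_Z gamma)(X) xi) at [x] *)
Definition Dhat_gamma (C : charge_conjugation)
    (nab : M -> 'rV[R]_n -> (M -> 'rV[R]_n) -> 'rV[R]_n)
    (D : M -> 'rV[R]_n -> (M -> 'cV[R[i]]_N) -> 'cV[R[i]]_N)
    (A : M -> 'rV[R]_n -> 'M[R[i]]_N)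
    (Z X : M -> 'rV[R]_n) (xi : M -> 'cV[R[i]]_N) (x : M) : 'cV[R[i]]_N :=
  D x (Z x) (fun y => clif S y (X y) *m xi y)
  - clif S x (nab x (Z x) X) *m xi x
  - clif S x (X x) *m conj_connection C (spin_nabla nab) A x (Z x) xi.

(* Vector fields and spinors are allowed to be defined on open subsets. *)
Definition admissible (C : charge_conjugation)
    (nab : M -> 'rV[R]_n -> (M -> 'rV[R]_n) -> 'rV[R]_n)
    (D : M -> 'rV[R]_n -> (M -> 'cV[R[i]]_N) -> 'cV[R[i]]_N)
    (A : M -> 'rV[R]_n -> 'M[R[i]]_N) : Prop :=
  forall U X Y xi x, open U -> vsmooth U X -> vsmooth U Y -> ssmooth U xi ->
    U x ->
    Dhat_gamma C nab D A X Y xi x = - Dhat_gamma C nab D A Y X xi x.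

(* Complex k-forms on the tangent space are functions on lists of vectors,
   vanishing on the lists whose length is not k. In particular a form of
   degree -1 is zero. *)
Record is_altform (k : int) (w : seq 'rV[R]_n -> R[i]) : Prop := IsAltform {
  alt_degree : forall s, (size s)%:Z <> k -> w s = 0;
  alt_linear : forall s1 s2 a u v,
    w (s1 ++ (a *: u + v) :: s2) = a%:C * w (s1 ++ u :: s2) + w (s1 ++ v :: s2);
  alt_alternating : forall s, ~~ uniq s -> w s = 0
}.

Record is_form (k : int) (U : set M) (w : M -> seq 'rV[R]_n -> R[i]) : Prop :=
  IsForm {
  form_alt : forall x, U x -> is_altform k (w x);
  form_smooth : forall V (Xs : seq (M -> 'rV[R]_n)), open V -> V `<=` U ->
    (forall i, (i < size Xs)%N -> vsmooth V (nth (fun=> 0) Xs i)) ->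
    csmooth V (fun x => w x [seq X x | X <- Xs])
}.

Definition contract (v : 'rV[R]_n) (w : seq 'rV[R]_n -> R[i])
    (s : seq 'rV[R]_n) : R[i] := w (v :: s).

(* The exterior product of the 1-form g(v, -) with w *)
Definition wedge (x : M) (v : 'rV[R]_n) (w : seq 'rV[R]_n -> R[i])
    (s : seq 'rV[R]_n) : R[i] :=
  \sum_(i < size s) (-1) ^+ i * (inner g x v (nth 0 s i))%:C *
    w (take i s ++ drop i.+1 s).

(* The endomorphism 1/k! w_(m_1 ... m_k) gamma^(m_1 ... m_k), with indices
   raised by eta *)
Definition form_endo (x : M) (k : nat) (w : seq 'rV[R]_n -> R[i])
    : 'M[R[i]]_N :=
  (k`!%:R)^-1 *:
  \sum_(m : {ffun 'I_k -> 'I_n})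
    ((\prod_i eta S (m i))%:C * w [seq frame S x x (m i) | i <- enum 'I_k]) *:
    gamma_skew x (fun i => frame S x x (m i)).

Definition homogeneous (k : nat) (A : M -> 'rV[R]_n -> 'M[R[i]]_N) : Prop :=
  forall U X, open U -> vsmooth U X ->
    exists2 w, is_form k%:Z U w &
      forall x, U x -> A x (X x) = form_endo x k (w x).

(* The bilinear form induced by g on T* (x) Lambda^k at [x] *)
Definition form1_inner (x : M) (k : nat)
    (B B' : 'rV[R]_n -> seq 'rV[R]_n -> R[i]) : R[i] :=
  (k`!%:R)^-1 *
  \sum_a \sum_(m : {ffun 'I_k -> 'I_n})
    (eta S a * \prod_i eta S (m i))%:C *
    (B (frame S x x a) [seq frame S x x (m i) | i <- enum 'I_k] *
     B' (frame S x x a) [seq frame S x x (m i) | i <- enum 'I_k]).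

(* Sections of Omega^1 (x) Omega^k *)
Record is_form1 (k : nat) (B : M -> 'rV[R]_n -> seq 'rV[R]_n -> R[i]) : Prop :=
  IsForm1 {
  form1_linear : forall x a u v s, B x (a *: u + v) s = a%:C * B x u s + B x v s;
  form1_alt : forall x v, is_altform k%:Z (B x v);
  form1_smooth : forall U X, open U -> vsmooth U X ->
    is_form k%:Z U (fun x => B x (X x))
}.

(* Omega^(k,1): the sections of the complement of Omega^(k+1) + Omega^(k-1) in
   Omega^1 (x) Omega^k, i.e. of their orthogonal complement, which is the
   unique complement invariant under the orthogonal group. *)
Definition is_hook (k : nat) (B : M -> 'rV[R]_n -> seq 'rV[R]_n -> R[i])
    : Prop :=
  [/\ is_form1 k B,
      forall x w, is_altform (k%:Z + 1) w ->
        form1_inner x k (B x) (fun v => contract v w) = 0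
    & forall x w, is_altform (k%:Z - 1) w ->
        form1_inner x k (B x) (fun v => wedge x v w) = 0].

(* A_X = X _| F + X /\ G + A0(X) *)
Definition decomposes (l : nat) (A : M -> 'rV[R]_n -> 'M[R[i]]_N)
    (F G : M -> seq 'rV[R]_n -> R[i])
    (A0 : M -> 'rV[R]_n -> seq 'rV[R]_n -> R[i]) : Prop :=
  [/\ is_form (l%:Z + 1) setT F, is_form (l%:Z - 1) setT G, is_hook l A0
    & forall x v, A x v =
        form_endo x l
          (fun s => contract v (F x) s + wedge x v (G x) s + A0 x v s)].

End Spinors.
End Calculus.

(* Main.v *)
From mathcomp Require Import ring functions landau.
Require Import Defs.

Set Implicit Arguments.
Unset Strict Implicit.
Unset Printing Implicit Defensive.
Local Open Scope ring_scope.

(** Fix x and an orthonormal frame.  Writing E for the map from forms to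
endomorphisms, moving gamma(u) through a product of gammas one factor at a
time gives gamma(u) E(w) = E(u /\ w) - E(u _| w) and
E(w) gamma(u) = (-1)^k (E(u /\ w) + E(u _| w)) for a k-form w.  Hence E(w) = 0
implies E(u _| w) = 0 for all u, and by induction on k the map E is injective
on k-forms, for each single k and also in odd dimensions.

Since nabla gamma = 0, (Dhat_u gamma)(v) is the endomorphism
A_u gamma(v) + gamma(v) A_u^C, and A^C = Delta_0 Delta_l A.  With
A_u = E(B_u) this is a multiple of E(v /\ B_u) if
Delta_0 Delta_l = (-1)^l, and of E(v _| B_u) otherwise.  Skewness of
v /\ B_u in (u, v) forces B_u = u /\ G (contract with e_a and sum over a), and
skewness of v _| B_u means that B is totally alternating, B_u = u _| F.

The components of B in Omega^(l+1) and Omega^(l-1) are, up to nonzero factors,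
its alternation and its trace, and Omega^(l,1) is the common kernel of both. *)

(** In odd dimensions the images under E of forms of different degrees overlap, so a relation
    between E of an (l+1)-form and E of an (l-1)-form could not be split by degree. Charge
    conjugation avoids this: A^C is plus or minus A, so (Dhat_u gamma)(v) is an anticommutator or a
    commutator of A_u with gamma(v), exactly one of the two degrees survives, and injectivity of E
    on a single degree suffices. The conditions Delta_1 Delta_deg = -1 for deg = l + 1 and deg = l -
    1 are complementary, so for given l only one of F and G may be non-zero.

    The nonzero factors are l + 1 for the alternation of u _| F, one for each slot of F, and n - l +
    1 for the trace of u /\ G, which is positive because l <= n.

    Forms are functions on lists of vectors, so inductions run over the argument list and contract
    with its head. Degrees are integers, which keeps contraction meaningful down to degree -1 and
    below. *)

Local Open Scope complex_scope.

(** * Alternating forms *)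

Section AlternatingForms.
Variables (R : realType) (n : nat).
Local Notation V := 'rV[R]_n.
Local Notation K := R[i].
Implicit Types (w : seq V -> K) (B : V -> seq V -> K) (s t : seq V) (k : int).

Lemma altform0 k w s1 s2 : is_altform k w -> w (s1 ++ 0 :: s2) = 0.
Proof.
move=> Hw; have := alt_linear Hw s1 s2 1 0 0.
by rewrite scale1r addr0 mul1r => /eqP; rewrite -subr_eq subrr eq_sym => /eqP.
Qed.

Lemma altformD k w s1 s2 u v : is_altform k w ->
  w (s1 ++ (u + v) :: s2) = w (s1 ++ u :: s2) + w (s1 ++ v :: s2).
Proof. by move=> Hw; rewrite -[u]scale1r (alt_linear Hw) mul1r scale1r. Qed.

Lemma altformZ k w s1 s2 a u : is_altform k w ->
  w (s1 ++ (a *: u) :: s2) = a%:C * w (s1 ++ u :: s2).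
Proof.
by move=> Hw; rewrite -[a *: u]addr0 (alt_linear Hw) (altform0 _ _ Hw) addr0.
Qed.

Lemma altform_sum k w (I : finType) (c : I -> R) (f : I -> V) t :
  is_altform k w ->
  w ((\sum_i c i *: f i) :: t) = \sum_i (c i)%:C * w (f i :: t).
Proof.
move=> Hw; elim/big_ind2: _ => [|x X y Y <- <-|i _].
- exact: (altform0 [::] _ Hw).
- exact: (altformD [::] _ _ _ Hw).
- exact: (altformZ [::] _ _ _ Hw).
Qed.

Lemma altform_swap k w u v t : is_altform k w ->
  w (u :: v :: t) = - w (v :: u :: t).
Proof.
move=> Hw; have H z : w (z :: z :: t) = 0.
  by apply: (alt_alternating Hw); rewrite /= inE eqxx.
have := H (u + v).
rewrite (altformD [::] _ _ _ Hw) (altformD [:: u] _ _ _ Hw).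
rewrite (altformD [:: v] _ _ _ Hw) /= !H add0r addr0 => /eqP.
by rewrite addr_eq0 => /eqP.
Qed.

Lemma contract_altform k w v :
  is_altform k w -> is_altform (k - 1) (contract v w).
Proof.
move=> Hw; split=> [s Hs|s1 s2 a x y|s Hs]; rewrite /contract.
- apply: (alt_degree Hw) => /= E; apply: Hs.
  by rewrite -E intS addrC addKr.
- exact: (alt_linear Hw (v :: s1)).
- by apply: (alt_alternating Hw); rewrite /= (negbTE Hs) andbF.
Qed.

(** Peeling off the head of [s1] replaces [w] by its contraction, again an alternating form, and
    costs one swap of adjacent vectors. *)
Lemma altform_move k w s1 v s2 : is_altform k w ->
  w (s1 ++ v :: s2) = (-1) ^+ size s1 * w (v :: s1 ++ s2).
Proof.
elim: s1 k w => [|u s1 IH] k w Hw /=; first by rewrite expr0 mul1r.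
rewrite -[LHS]/(contract u w (s1 ++ v :: s2)) (IH _ _ (contract_altform u Hw)).
by rewrite /contract (altform_swap _ _ _ Hw) mulrN exprS mulN1r mulNr.
Qed.

(** Both vectors are brought to the front, where they are neighbours. The signs of these moves
    depend only on the lengths of [s1] and [s2], so they agree on the two sides. *)
Lemma altform_transpose k w s1 u s2 v s3 : is_altform k w ->
  w (s1 ++ u :: s2 ++ v :: s3) = - w (s1 ++ v :: s2 ++ u :: s3).
Proof.
move=> Hw; rewrite (altform_move s1 _ _ Hw) [in RHS](altform_move s1 _ _ Hw).
rewrite -!cat_cons !catA (altform_move _ _ _ Hw) [in RHS](altform_move _ _ _ Hw).
by rewrite /= !size_cat /= (altform_swap _ _ _ Hw) !mulrN.
Qed.

Lemma altform_tperm k w (T : finType) (f : T -> V) (l : seq T) (i j : T) :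
  is_altform k w -> uniq l -> i \in l -> j \in l -> i != j ->
  w [seq f (tperm i j x) | x <- l] = - w [seq f x | x <- l].
Proof.
move=> Hw; wlog: i j / exists s1 s2 s3 : seq T, l = s1 ++ i :: s2 ++ j :: s3.
  move=> wl Ul il jl ij.
  case/splitPr: {2}l / (il) (erefl l) => s1 s2 El.
  move: (jl); rewrite El mem_cat inE eq_sym (negbTE ij) /=.
  case/orP=> js.
    have ji : j != i by rewrite eq_sym.
    rewrite -El tpermC; apply: wl => //.
    case/splitPr: js El => s3 s4 El.
    by exists s3, s4, s2; rewrite El -catA.
  rewrite -El; apply: wl => //.
  by case/splitPr: js El => s3 s4 El; exists s1, s3, s4.
case=> s1 [s2 [s3 ->]] Ul _ _ ij.
have tpermE (s : seq T) : i \notin s -> j \notin s ->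
    [seq f (tperm i j x) | x <- s] = [seq f x | x <- s].
  move=> si sj; apply/eq_in_map => x xs.
  by rewrite tpermD //; [apply: contraNneq si | apply: contraNneq sj] => ->.
have : uniq (i :: j :: s1 ++ s2 ++ s3).
  rewrite -(perm_uniq (s1 := s1 ++ i :: s2 ++ j :: s3)) //.
  rewrite -cat1s perm_catCA /= perm_cons -[j :: s3]cat1s.
  by rewrite catA (perm_catCA _ [:: j]) /= perm_cons catA.
rewrite /= !inE !mem_cat !negb_or => /and3P[/and4P[_ i1 i2 i3]].
case/and3P=> j1 j2 j3 _.
rewrite !map_cat /= !map_cat /= !tpermE // tpermL tpermR.
exact: altform_transpose Hw.
Qed.

Lemma altform_perm k w (T : finType) (f : T -> V) (s : {perm T}) (l : seq T) :
  is_altform k w -> uniq l -> (forall x, x \in l) ->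
  w [seq f (s x) | x <- l] = (-1) ^+ s * w [seq f x | x <- l].
Proof.
move=> Hw Ul Al; have [ts -> Ht] := prod_tpermP s.
elim: ts Ht f => [_|[i j] ts IH /andP[/= ij Ht]] f.
  rewrite big_nil odd_perm1 expr0 mul1r; congr w.
  by apply: eq_map => x; rewrite perm1.
rewrite big_cons odd_permM odd_tperm ij signr_addb expr1 mulN1r mulNr -IH //.
rewrite -(altform_tperm _ Hw Ul (Al i) (Al j) ij); congr w.
by apply: eq_map => x; rewrite permM.
Qed.

(** The unnormalised alternation of an element of Omega^1 (x) Omega^k. The exterior product with
    g(v, -) is the special case B u t = g(v, u) w(t), so both operations share the recursion
    [alternate_cons]. *)
Definition alternate B s : K :=
  \sum_(i < size s) (-1) ^+ i * B (nth 0 s i) (take i s ++ drop i.+1 s).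

Lemma alternate_nil B : alternate B [::] = 0.
Proof. by rewrite /alternate big_ord0. Qed.

Lemma alternate_cons B u s :
  alternate B (u :: s) = B u s - alternate (fun v t => B v (u :: t)) s.
Proof.
rewrite /alternate big_ord_recl /= drop0 expr0 mul1r -sumrN; congr (_ + _).
by apply: eq_bigr => i _; rewrite /bump /= exprS mulN1r mulNr.
Qed.

Lemma eq_alternate B B' s :
  (forall u t, B u t = B' u t) -> alternate B s = alternate B' s.
Proof. by move=> E; apply: eq_bigr => i _; rewrite E. Qed.

Lemma alternateD B B' s :
  alternate (fun u t => B u t + B' u t) s = alternate B s + alternate B' s.
Proof. by rewrite -big_split; apply: eq_bigr => i _; rewrite mulrDr. Qed.

Lemma alternateZ B (c : K) s :
  alternate (fun u t => c * B u t) s = c * alternate B s.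
Proof. by rewrite big_distrr; apply: eq_bigr => i _; rewrite /= mulrCA. Qed.

Lemma alternateN B s : alternate (fun u t => - B u t) s = - alternate B s.
Proof. by rewrite -sumrN; apply: eq_bigr => i _; rewrite mulrN. Qed.

Lemma alternate0 s : alternate (fun _ _ => 0) s = 0.
Proof. by rewrite /alternate big1 // => i _; rewrite mulr0. Qed.

Lemma alternate_sum (I : finType) (F : I -> V -> seq V -> K) s :
  alternate (fun u t => \sum_i F i u t) s = \sum_i alternate (F i) s.
Proof.
by rewrite exchange_big; apply: eq_bigr => i _; rewrite big_distrr.
Qed.

Lemma alternate_single B s1 x s2 :
  (forall u t, x \in t -> B u t = 0) ->
  alternate B (s1 ++ x :: s2) = (-1) ^+ size s1 * B x (s1 ++ s2).
Proof.
elim: s1 B => [|y s1 IH] B HB /=; rewrite alternate_cons.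
  rewrite expr0 mul1r -[RHS]subr0; congr (_ - _).
  transitivity (alternate (fun _ _ => 0) s2); last exact: alternate0.
  by apply: eq_alternate => u t; rewrite HB // inE eqxx.
rewrite HB ?mem_cat ?inE ?eqxx ?orbT // add0r IH; last first.
  by move=> u t xt; rewrite HB // inE xt orbT.
by rewrite exprS mulN1r mulNr.
Qed.

Lemma alternate_altform k B :
    (forall u, is_altform k (B u)) ->
    (forall a u v t, B (a *: u + v) t = a%:C * B u t + B v t) ->
  is_altform (k + 1) (alternate B).
Proof.
move=> HB LB; split=> [s Hs|s1 s2 a u v|s].
- case: s Hs => [|x s] Hs; first exact: alternate_nil.
  rewrite /alternate big1 // => i _; rewrite (alt_degree (HB _)) ?mulr0 //.
  rewrite size_cat size_take size_drop /= ltn_ord subSS subnKC; last first.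
    by rewrite -ltnS.
  by move=> E; apply: Hs; rewrite -E /= intS addrC.
- elim: s1 k B HB LB => [|y s1 IH] k B HB LB /=.
    rewrite !alternate_cons LB mulrBr -!addrA; congr (_ + _).
    rewrite [RHS]addrC -addrA; congr (_ + _).
    rewrite -opprD; congr (- _); rewrite -alternateZ -alternateD.
    apply: eq_alternate => w t; rewrite [RHS]addrC.
    exact: (alt_linear (HB w) [::]).
  rewrite !alternate_cons (alt_linear (HB y)).
  rewrite (IH (k - 1)) => [|w|b w1 w2 t]; last exact: LB.
    by rewrite mulrBr opprD addrACA.
  exact: contract_altform.
- elim: s k B HB LB => [|y s IH] k B HB LB //= nU.
  (* If the head [y] occurs again in [s], only the term of the tail that removes this second
     occurrence survives, and it cancels against [B y s]. *)
  rewrite alternate_cons; have [ys|ys] := boolP (y \in s).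
    case/splitPr: ys {nU} => s1 s2.
    rewrite (altform_move _ _ _ (HB y)) alternate_single ?subrr //.
    by move=> u t yt; rewrite (alt_alternating (HB u)) //= yt.
  move: nU; rewrite ys /= => nU; rewrite (alt_alternating (HB y) nU) sub0r.
  by rewrite (IH (k - 1)) ?oppr0 // => u; exact: contract_altform.
Qed.

(** Moving each removed entry back to its place absorbs the sign, so all [size s] terms equal
    [w s]. *)
Lemma alternate_contract k w s :
  is_altform k w -> alternate (fun v => contract v w) s = (size s)%:R * w s.
Proof.
move=> Hw; rewrite -[X in X%:R * _]card_ord -sum1_card natr_sum mulr_suml.
apply: eq_bigr => i _; rewrite mul1r -[s in RHS](cat_take_drop i).
rewrite (drop_nth 0 (ltn_ord i)) (altform_move _ _ _ Hw) size_take ltn_ord.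
by [].
Qed.

End AlternatingForms.

(** * The metric and expansions in orthonormal frames *)

Section Inner.
Variables (R : realType) (n : nat) (M : manifold R n) (g : metric M) (x : M).
Local Notation V := 'rV[R]_n.
Local Notation h := (inner g x).

Lemma inner_sym u v : h u v = h v u.
Proof.
rewrite /inner /mx_inner -[LHS]/(_ ord0 ord0) -[in LHS](trmxK (u *m _ *m _)).
by rewrite mxE !trmx_mul trmxK gram_sym mulmxA.
Qed.

Lemma inner_linearl a u v w : h (a *: u + v) w = a * h u w + h v w.
Proof. by rewrite /inner /mx_inner !mulmxDl -!scalemxAl !mxE. Qed.

Lemma inner_linearr a u v w : h w (a *: u + v) = a * h w u + h w v.
Proof. by rewrite inner_sym inner_linearl ![h w _]inner_sym. Qed.

Lemma inner0l w : h 0 w = 0.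
Proof. by rewrite /inner /mx_inner !mul0mx mxE. Qed.

Lemma inner_suml (I : finType) (c : I -> R) (f : I -> V) w :
  h (\sum_i c i *: f i) w = \sum_i c i * h (f i) w.
Proof.
elim/big_ind2: _ => [|t1 u1 t2 u2 <- <-|i _]; first exact: inner0l.
  by rewrite -[u1]scale1r inner_linearl mul1r scale1r.
by rewrite -[c i *: _]addr0 inner_linearl inner0l addr0.
Qed.

Section Frame.
Variables (eta : 'I_n -> R) (e : 'I_n -> V).
Hypothesis eta2 : forall a, eta a * eta a = 1.
Hypothesis e_orth : forall a b, h (e a) (e b) = if a == b then eta a else 0.

Lemma frame_expand u : u = \sum_a (eta a * h (e a) u) *: e a.
Proof.
pose P : 'M[R]_n := \matrix_a e a; pose H : 'M[R]_n := diag_mx (\row_a eta a).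
have PE a b : (P *m gram g x *m P^T) a b = h (e a) (e b).
  rewrite /inner /mx_inner [RHS]mxE [LHS]mxE; apply: eq_bigr => j _.
  by rewrite !mxE; congr (_ * _); apply: eq_bigr => k _; rewrite !mxE.
have : P *m (gram g x *m P^T *m H) = 1%:M.
  apply/matrixP => a b; rewrite !mulmxA mul_mx_diag mxE PE e_orth !mxE.
  by case: eqP => [->|_]; rewrite ?eta2 ?mul0r.
(* Orthonormality exhibits a right inverse of the square matrix [P]. It is also a left inverse,
   which is the completeness of the frame. *)
move/mulmx1C => E; rewrite -[LHS]mulmx1 -E !mulmxA [LHS]mulmx_sum_row.
apply: eq_bigr => a _; rewrite rowK mul_mx_diag mxE [X in _ * X]mxE mulrC.
rewrite inner_sym /inner /mx_inner [X in _ * X]mxE; congr ((_ * _) *: _).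
by rewrite [RHS]mxE; apply: eq_bigr => k _; rewrite !mxE.
Qed.

End Frame.
End Inner.

(** * Exterior products, contractions and traces at a point *)

Section Forms.
Variables (R : realType) (n : nat) (M : manifold R n) (g : metric M) (x : M).
Local Notation V := 'rV[R]_n.
Local Notation K := R[i].
Local Notation h := (inner g x).
Implicit Types (w : seq V -> K) (B : V -> seq V -> K) (s t : seq V) (k : int).

Lemma wedgeE v w s :
  wedge g x v w s = alternate (fun u t => (h v u)%:C * w t) s.
Proof. by apply: eq_bigr => i _; rewrite mulrA. Qed.

Lemma eq_wedge v w w' s : w =1 w' -> wedge g x v w s = wedge g x v w' s.
Proof. by move=> E; apply: eq_bigr => i _; rewrite E. Qed.

Lemma wedgeD v w w' s :
  wedge g x v (fun t => w t + w' t) s = wedge g x v w s + wedge g x v w' s.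
Proof. by rewrite -big_split; apply: eq_bigr => i _; rewrite mulrDr. Qed.

Lemma wedgeZ v (c : K) w s :
  wedge g x v (fun t => c * w t) s = c * wedge g x v w s.
Proof. by rewrite big_distrr; apply: eq_bigr => i _; rewrite /= mulrCA. Qed.

Lemma wedge_sum v (I : finType) (F : I -> seq V -> K) s :
  wedge g x v (fun t => \sum_i F i t) s = \sum_i wedge g x v (F i) s.
Proof. by rewrite exchange_big; apply: eq_bigr => i _; rewrite big_distrr. Qed.

Lemma wedge_linear a u v w s :
  wedge g x (a *: u + v) w s = a%:C * wedge g x u w s + wedge g x v w s.
Proof.
rewrite big_distrr -big_split; apply: eq_bigr => i _.
rewrite inner_linearl rmorphD rmorphM /= mulrDr mulrDl !mulrA.
by rewrite -[_ * a%:C]mulrC.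
Qed.

Lemma contract_wedge u v w s :
  contract u (wedge g x v w) s = (h v u)%:C * w s - wedge g x v (contract u w) s.
Proof. by rewrite /contract !wedgeE alternate_cons. Qed.

Lemma wedge_altform k v w :
  is_altform k w -> is_altform (k + 1) (wedge g x v w).
Proof.
move=> Hw; rewrite (_ : wedge g x v w = alternate (fun u t => (h v u)%:C * w t)).
  apply: alternate_altform => [u|a u1 u2 t]; last first.
    by rewrite inner_linearr rmorphD rmorphM /= mulrDl mulrA.
  split=> [s Hs|s1 s2 a u1 u2|s Hs].
  - by rewrite (alt_degree Hw) ?mulr0.
  - by rewrite (alt_linear Hw) mulrDr mulrCA.
  - by rewrite (alt_alternating Hw) ?mulr0.
by apply: funext => s; rewrite wedgeE.
Qed.

Lemma wedge_anticomm u v w s :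
  wedge g x u (wedge g x v w) s = - wedge g x v (wedge g x u w) s.
Proof.
elim: s u v w => [|y s IH] u v w; first by rewrite /wedge !big_ord0 oppr0.
rewrite -![wedge _ _ _ _ (y :: s)]/(contract y (wedge _ _ _ _) s).
have E u' v' : wedge g x u' (contract y (wedge g x v' w)) s =
    (h v' y)%:C * wedge g x u' w s - wedge g x u' (wedge g x v' (contract y w)) s.
  rewrite (eq_wedge _ _ (contract_wedge y v' w)) wedgeD wedgeZ; congr (_ + _).
  rewrite -mulN1r -wedgeZ; apply: eq_wedge => t; by rewrite mulN1r.
by rewrite !contract_wedge !E (IH u); ring.
Qed.

(** The symmetric expression g(u, v) is alternated in both of its slots. Thus the part u /\ G of the
    decomposition does not contribute to the alternation. *)
Lemma alternate_wedge w s : alternate (fun v => wedge g x v w) s = 0.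
Proof.
elim: s w => [|y s IH] w; first exact: alternate_nil.
rewrite alternate_cons; under eq_alternate => u t.
  rewrite -[wedge _ _ _ _ _]/(contract y (wedge g x u w) t) contract_wedge.
  rewrite inner_sym; over.
by rewrite alternateD alternateN IH subr0 -wedgeE subrr.
Qed.

Section Trace.
Variables (eta : 'I_n -> R) (e : 'I_n -> V).
Hypothesis eta2 : forall a, eta a * eta a = 1.
Hypothesis e_orth : forall a b, h (e a) (e b) = if a == b then eta a else 0.

(** The metric contraction of the Omega^1 slot with the first slot of the form. *)
Definition trace1 B s : K := \sum_a (eta a)%:C * B (e a) (e a :: s).

Lemma trace1D B B' s :
  trace1 (fun u t => B u t + B' u t) s = trace1 B s + trace1 B' s.
Proof. by rewrite -big_split; apply: eq_bigr => i _; rewrite mulrDr. Qed.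

Lemma trace1_altform k B :
  (forall u, is_altform k (B u)) -> is_altform (k - 1) (trace1 B).
Proof.
move=> HB; have H a := contract_altform (e a) (HB (e a)).
split=> [s Hs|s1 s2 a u v|s Hs].
- by rewrite /trace1 big1 // => i _; rewrite [B _ _](alt_degree (H i)) ?mulr0.
- rewrite big_distrr -big_split; apply: eq_bigr => i _ /=.
  by rewrite [B _ _](alt_linear (H i)) mulrDr mulrCA.
- by rewrite /trace1 big1 // => i _; rewrite [B _ _](alt_alternating (H i)) ?mulr0.
Qed.

Lemma trace1_contract k w s :
  is_altform k w -> trace1 (fun v => contract v w) s = 0.
Proof.
move=> Hw; rewrite /trace1 big1 // => a _.
by rewrite /contract (alt_alternating Hw) ?mulr0 //= inE eqxx.
Qed.

Lemma altform_expand k w u t : is_altform k w ->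
  w (u :: t) = \sum_a (eta a * h (e a) u)%:C * w (e a :: t).
Proof.
by move=> Hw; rewrite {1}(frame_expand eta2 e_orth u) (altform_sum _ _ _ Hw).
Qed.

(** By the antiderivation rule [contract_wedge] each [a] contributes [w] minus eta_a e_a /\ (e_a _|
    w). The first terms add up to n w, and the second ones form the operator counting the degree.
    For degree l - 1 the factor is n - l + 1. *)
Lemma trace1_wedge k w s : is_altform k w ->
  trace1 (fun v => wedge g x v w) s = (n%:R - (size s)%:R) * w s.
Proof.
move=> Hw; rewrite /trace1; under eq_bigr => a _.
  rewrite -[wedge _ _ _ _ _]/(contract (e a) (wedge g x (e a) w) s).
  rewrite contract_wedge e_orth eqxx mulrBr mulrA -rmorphM eta2 mul1r; over.
rewrite sumrB sumr_const card_ord mulrBl -[w s *+ n]mulr_natl; congr (_ - _).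
rewrite -(alternate_contract _ Hw).
under eq_bigr do rewrite wedgeE -alternateZ.
rewrite -alternate_sum; apply: eq_alternate => u t.
rewrite /contract (altform_expand _ _ Hw); apply: eq_bigr => a _.
by rewrite mulrA -rmorphM.
Qed.

Lemma wedge_trace1 v B s :
  wedge g x v (trace1 B) s =
  \sum_a (eta a)%:C * wedge g x v (contract (e a) (B (e a))) s.
Proof.
by rewrite wedge_sum; apply: eq_bigr => a _; rewrite wedgeZ.
Qed.

End Trace.

Lemma linear_expand B (eta : 'I_n -> R) (e : 'I_n -> V) :
    (forall a, eta a * eta a = 1) ->
    (forall a b, h (e a) (e b) = if a == b then eta a else 0) ->
    (forall a u v t, B (a *: u + v) t = a%:C * B u t + B v t) ->
  forall u t, B u t = \sum_a (eta a * h (e a) u)%:C * B (e a) t.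
Proof.
move=> eta2 He LB u t; rewrite {1}(frame_expand eta2 He u).
have B0 : B 0 t = 0.
  have := LB 1 0 0 t.
  by rewrite scale1r addr0 mul1r => /eqP; rewrite -subr_eq subrr eq_sym => /eqP.
elim/big_ind2: _ => [//|t1 u1 t2 u2 <- <-|i _].
  by rewrite -[u1]scale1r LB mul1r scale1r.
by rewrite -[_ *: _]addr0 LB B0 addr0.
Qed.

(** Expanding one slot of [B] in the other frame turns both traces into the same double sum with
    coefficients g(e_a, e'_c). This allows the trace to be computed in a frame that is smooth near a
    given point. *)
Lemma trace1_frame k B (eta : 'I_n -> R) (e e' : 'I_n -> V) s :
    (forall a, eta a * eta a = 1) ->
    (forall a b, h (e a) (e b) = if a == b then eta a else 0) ->
    (forall a b, h (e' a) (e' b) = if a == b then eta a else 0) ->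
    (forall u, is_altform k (B u)) ->
    (forall a u v t, B (a *: u + v) t = a%:C * B u t + B v t) ->
  trace1 eta e B s = trace1 eta e' B s.
Proof.
move=> eta2 He He' HB LB; rewrite /trace1.
have BE := linear_expand eta2 He LB.
transitivity (\sum_c \sum_a (eta c * eta a * h (e a) (e' c))%:C
    * B (e a) (e' c :: s)); last first.
  apply: eq_bigr => c _; rewrite BE big_distrr; apply: eq_bigr => a _ /=.
  by rewrite mulrA -rmorphM mulrA.
rewrite exchange_big; apply: eq_bigr => a _.
rewrite (altform_expand eta2 He' _ _ (HB _)) big_distrr; apply: eq_bigr => c _.
by rewrite /= mulrA -rmorphM inner_sym mulrA [eta a * _]mulrC.
Qed.

End Forms.

(** * Sums over lists of indices and the orthogonal complement *)

Section ListSums.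
Variables (I : finType).

(** Multi-indices are lists here rather than functions on ['I_k]: forms take lists as arguments, and
    the proofs insert or delete single entries. *)
Fixpoint list_sum (W : nmodType) k (phi : seq I -> W) : W :=
  if k is k'.+1 then \sum_a list_sum k' (fun t => phi (a :: t)) else phi [::].

Lemma eq_list_sum (W : nmodType) k (phi psi : seq I -> W) :
  (forall t, size t = k -> phi t = psi t) -> list_sum k phi = list_sum k psi.
Proof.
elim: k phi psi => [|k IH] phi psi E /=; first exact: E.
by apply: eq_bigr => a _; apply: IH => t Ht; apply: E; rewrite /= Ht.
Qed.

Lemma list_sum0 (W : nmodType) k : list_sum k (fun _ : seq I => 0 : W) = 0.
Proof. by elim: k => //= k ->; rewrite big1. Qed.

Lemma list_sumD (W : nmodType) k (phi psi : seq I -> W) :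
  list_sum k (fun t => phi t + psi t) = list_sum k phi + list_sum k psi.
Proof.
by elim: k phi psi => //= k IH phi psi; under eq_bigr do rewrite IH; rewrite big_split.
Qed.

Lemma list_sum_sum (W : nmodType) (J : finType) k (F : J -> seq I -> W) :
  list_sum k (fun t => \sum_j F j t) = \sum_j list_sum k (F j).
Proof.
elim: k F => //= k IH F; under eq_bigr do rewrite IH.
by rewrite exchange_big.
Qed.

Lemma raddf_list_sum (W W' : zmodType) (f : {additive W -> W'}) k
    (phi : seq I -> W) :
  f (list_sum k phi) = list_sum k (fun t => f (phi t)).
Proof.
by elim: k phi => //= k IH phi; rewrite raddf_sum; apply: eq_bigr => a _.
Qed.

(** Singles out the entry at position [i], which is the one that the i-th term of [alternate] or
    [wedge] removes. *)
Lemma list_sum_insert (W : nmodType) k i (phi : seq I -> W) : (i <= k)%N ->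
  list_sum k.+1 phi =
  \sum_a list_sum k (fun t => phi (take i t ++ a :: drop i t)).
Proof.
elim: i k phi => [|i IH] k phi ik.
  by apply: eq_bigr => a _; apply: eq_list_sum => t _; rewrite take0 drop0.
case: k ik => // k ik; transitivity (\sum_b list_sum k.+1 (fun t => phi (b :: t))).
  by [].
by under eq_bigr do rewrite (IH k) //; rewrite exchange_big.
Qed.

Lemma big_ffun_list_sum (W : nmodType) k (phi : seq I -> W) :
  \sum_(m : {ffun 'I_k -> I}) phi [seq m i | i <- enum 'I_k] = list_sum k phi.
Proof.
elim: k phi => [|k IH] phi.
  rewrite (eq_bigr (fun=> phi [::])) => [|m _]; last first.
    by congr phi; apply: size0nil; rewrite size_map size_enum_ord.
  by rewrite sumr_const card_ffun card_ord expn0.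
(* [F] and [F'] are the bijection between multi-indices of length k + 1 and pairs of a head and a
   tail. *)
pose F (p : I * {ffun 'I_k -> I}) : {ffun 'I_k.+1 -> I} :=
  [ffun i => if unlift ord0 i is Some j then p.2 j else p.1].
pose F' (m : {ffun 'I_k.+1 -> I}) := (m ord0, [ffun j => m (lift ord0 j)]).
rewrite (reindex F) /=; last first.
  exists F' => [[a m] _|m _].
    congr pair; first by rewrite ffunE unlift_none.
    by apply/ffunP => j; rewrite !ffunE liftK.
  by apply/ffunP => i; rewrite ffunE; case: unliftP => [j|] ->; rewrite ?ffunE.
rewrite -(pair_bigA _ (fun a m => phi [seq F (a, m) i | i <- enum 'I_k.+1])) /=.
apply: eq_bigr => a _; rewrite -IH; apply: eq_bigr => m _; congr phi.
rewrite enum_ordSl /= ffunE unlift_none; congr cons; rewrite -map_comp.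
by apply: eq_map => j; rewrite /= ffunE liftK.
Qed.

Lemma list_sum_ge0 (W : numDomainType) k (phi : seq I -> W) :
  (forall t, 0 <= phi t) -> 0 <= list_sum k phi.
Proof. by elim: k phi => //= k IH phi H; apply: sumr_ge0 => a _; apply: IH. Qed.

Lemma list_sum_eq0 (W : numDomainType) k (phi : seq I -> W) t :
  (forall t, 0 <= phi t) -> list_sum k phi = 0 -> size t = k -> phi t = 0.
Proof.
elim: k phi t => [|k IH] phi [|a t] //= H0 H [Ht].
apply: (IH (fun t => phi (a :: t))) => //.
have := H; move/psumr_eq0P => -> // b _.
by apply: list_sum_ge0.
Qed.

End ListSums.

Section Frames.
Variables (R : realType) (n : nat) (M : manifold R n) (g : metric M) (x : M).
Local Notation V := 'rV[R]_n.
Local Notation K := R[i].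
Local Notation h := (inner g x).
Variables (eta : 'I_n -> R) (e : 'I_n -> V).
Hypothesis eta2 : forall a, eta a * eta a = 1.
Hypothesis e_orth : forall a b, h (e a) (e b) = if a == b then eta a else 0.
Implicit Types (w : seq V -> K) (B : V -> seq V -> K).

Definition sign_prod (t : seq 'I_n) : R := \prod_(a <- t) eta a.

Lemma sign_prod_cons a t : sign_prod (a :: t) = eta a * sign_prod t.
Proof. by rewrite /sign_prod big_cons. Qed.

Lemma sign_prod_insert t1 a t2 :
  sign_prod (t1 ++ a :: t2) = eta a * sign_prod (t1 ++ t2).
Proof. by rewrite /sign_prod !big_cat big_cons /= mulrCA. Qed.

Lemma sign_prod2 t : sign_prod t * sign_prod t = 1.
Proof.
elim: t => [|a t IH]; first by rewrite /sign_prod big_nil mulr1.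
by rewrite sign_prod_cons mulrACA eta2 IH mulr1.
Qed.

Lemma altform_frame_eq0 (k : nat) w : is_altform k%:Z w ->
  (forall t, size t = k -> w [seq e a | a <- t] = 0) -> forall s, w s = 0.
Proof.
elim: k w => [|k IH] w Hw H [|u s].
- exact: (H [::]).
- by rewrite (alt_degree Hw).
- by rewrite (alt_degree Hw).
rewrite (altform_expand eta2 e_orth _ _ Hw) big1 // => a _.
have Ha : is_altform k%:Z (contract (e a) w).
  by have := contract_altform (e a) Hw; rewrite intS addrC addKr.
rewrite -[w _]/(contract (e a) w s) (IH _ Ha) ?mulr0 // => t Ht.
by rewrite -(H (a :: t)) //= Ht.
Qed.

Lemma altform_flip k w t : is_altform k w ->
  w [seq eta a *: e a | a <- t] = (sign_prod t)%:C * w [seq e a | a <- t].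
Proof.
elim: t k w => [|a t IH] k w Hw; first by rewrite /sign_prod big_nil mul1r.
rewrite /= (altformZ [::] _ _ _ Hw) -[w _]/(contract (e a) w _).
by rewrite (IH _ _ (contract_altform (e a) Hw)) mulrA -rmorphM sign_prod_cons.
Qed.

Lemma conjc_real (a : R) : ((a%:C)^* = a%:C :> K)%R.
Proof. by apply/eqP; rewrite eq_complex /= oppr0 !eqxx. Qed.

(* The test form is the complex conjugate of [w], precomposed with the map
   sending [e a] to [eta a *: e a] so that the pairing becomes definite. *)
Lemma altform_nondegenerate (k : nat) w : is_altform k%:Z w ->
    (forall w', is_altform k%:Z w' ->
      list_sum k (fun t => (sign_prod t)%:C *
        (w [seq e a | a <- t] * w' [seq e a | a <- t])) = 0) ->
  forall s, w s = 0.
Proof.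
move=> Hw H; apply: (altform_frame_eq0 Hw) => t Ht.
pose tau (v : V) : V := \sum_a h (e a) v *: e a.
have tau_linear a u v : tau (a *: u + v) = a *: tau u + tau v.
  rewrite scaler_sumr -big_split; apply: eq_bigr => b _.
  by rewrite inner_linearr scalerDl scalerA.
have tau_frame a : tau (e a) = eta a *: e a.
  rewrite /tau (bigD1 a) //= e_orth eqxx big1 ?addr0 // => b /negbTE ba.
  by rewrite e_orth ba scale0r.
pose w' s := ((w [seq tau v | v <- s])^*)%R.
have Hw' : is_altform k%:Z w'.
  split=> [s Hs|s1 s2 a u v|s Hs]; rewrite /w'.
  - by rewrite (alt_degree Hw) ?size_map // conjC0.
  - by rewrite !map_cat /= tau_linear (alt_linear Hw) rmorphD rmorphM /= conjc_real.
  - by rewrite (alt_alternating Hw) ?conjC0 //; apply: contra Hs => /map_uniq.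
have E u : (sign_prod u)%:C * (w [seq e a | a <- u] * w' [seq e a | a <- u]) =
    `|w [seq e a | a <- u]| ^+ 2.
  rewrite /w' -map_comp (eq_map tau_frame) (altform_flip _ Hw) normCK.
  rewrite rmorphM /= conjc_real mulrCA; congr (_ * _).
  by rewrite mulrA -rmorphM sign_prod2 mul1r.
have := H w' Hw'; rewrite (eq_list_sum (fun t _ => E t)) => H0.
have := list_sum_eq0 (fun t => exprn_ge0 2 (normr_ge0 (w [seq e a | a <- t]))) H0 Ht.
by move/eqP; rewrite expf_eq0 normr_eq0 => /eqP.
Qed.

End Frames.

(** * The pairing on Omega^1 (x) Omega^k and the adjoints of the two inclusions *)

Section Pairing.
Variables (R : realType) (n : nat) (M : manifold R n) (g : metric M).
Variables (S : spinor_bundle g) (x : M).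
Local Notation V := 'rV[R]_n.
Local Notation K := R[i].
Local Notation h := (inner g x).
Local Notation e := (frame S x x).
Local Notation mapf t := [seq frame S x x a | a <- t].
Local Notation sgn := (sign_prod (eta S)).
Implicit Types (w : seq V -> K) (B : V -> seq V -> K).

Lemma eta_sqr a : eta S a * eta S a = 1.
Proof. by case: (eta_sign S a) => ->; rewrite ?mulrNN mulr1. Qed.

Lemma frame_orth a b : h (e a) (e b) = if a == b then eta S a else 0.
Proof. exact: frame_orthonormal (sdom_mem S x). Qed.

Local Notation tr B := (trace1 (eta S) e B).

Lemma form1_innerE (k : nat) B B' :
  form1_inner S x k B B' = (k`!%:R)^-1 * \sum_a list_sum k (fun t =>
    (sgn (a :: t))%:C * (B (e a) (mapf t) * B' (e a) (mapf t))).
Proof.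
congr (_ * _); apply: eq_bigr => a _; rewrite -big_ffun_list_sum.
apply: eq_bigr => m _; rewrite sign_prod_cons /sign_prod big_map big_enum.
by rewrite -!map_comp; congr ((_ * _)%:C * _); apply: eq_bigl.
Qed.

(** Up to a factor, alternation is the adjoint of the inclusion of Omega^(k+1). Each of the k + 1
    positions of the removed entry yields the same sum, which explains the factor on the left. *)
Lemma form1_inner_contract (k : nat) B w : is_altform (k%:Z + 1) w ->
  (k.+1)%:R * form1_inner S x k B (fun v => contract v w) =
  (k`!%:R)^-1 * list_sum k.+1 (fun t =>
    (sgn t)%:C * (alternate B (mapf t) * w (mapf t))).
Proof.
move=> Hw; rewrite form1_innerE mulrCA; congr (_ * _); set X := \sum_a _.
transitivity (list_sum k.+1 (fun t => \sum_(i < k.+1) (sgn t)%:C *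
    ((-1) ^+ i * B (nth 0 (mapf t) i) (take i (mapf t) ++ drop i.+1 (mapf t)) *
     w (mapf t)))); last first.
  apply: eq_list_sum => t Ht; rewrite -mulr_sumr -mulr_suml.
  by rewrite /alternate size_map Ht.
rewrite list_sum_sum mulr_natl -[in LHS](card_ord k.+1) -sumr_const.
apply: eq_bigr => i _; have ik : (i <= k)%N by rewrite -ltnS.
rewrite (list_sum_insert _ ik); apply: eq_bigr => a _; apply: eq_list_sum => t Ht.
rewrite sign_prod_insert sign_prod_cons cat_take_drop.
have si : size (mapf (take i t)) = i by rewrite size_map size_takel // Ht.
rewrite map_cat /= nth_cat si ltnn subnn /= take_size_cat //.
rewrite -cat_rcons drop_size_cat ?size_rcons ?si // cat_rcons -map_cat cat_take_drop.
rewrite (altform_move _ _ _ Hw) si -map_cat cat_take_drop /contract; congr (_ * _).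
by rewrite -mulrA mulrCA signrMK.
Qed.

(** The trace is the adjoint of the inclusion by the exterior product. Here the k + 1 equal
    positions account for the ratio of (k+1)! and k!. *)
Lemma form1_inner_wedge (k : nat) B w : (forall v, is_altform k.+1%:Z (B v)) ->
  form1_inner S x k.+1 B (fun v => wedge g x v w) =
  (k`!%:R)^-1 * list_sum k (fun t =>
    (sgn t)%:C * (tr B (mapf t) * w (mapf t))).
Proof.
move=> HB; rewrite form1_innerE factS natrM invfM -mulrA [LHS]mulrCA.
congr (_ * _); apply: (canLR (mulKf _)); first by rewrite pnatr_eq0.
rewrite mulr_natl -[X in _ *+ X](card_ord k.+1) -sumr_const.
transitivity (\sum_a \sum_(i < k.+1) list_sum k.+1 (fun t => (sgn (a :: t))%:C *
    (B (e a) (mapf t) * ((-1) ^+ i * (h (e a) (nth 0 (mapf t) i))%:C *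
     w (take i (mapf t) ++ drop i.+1 (mapf t)))))).
  apply: eq_bigr => a _; rewrite -list_sum_sum; apply: eq_list_sum => t Ht.
  by rewrite -!mulr_sumr /wedge size_map Ht.
rewrite exchange_big; apply: eq_bigr => i _.
have ik : (i <= k)%N by rewrite -ltnS.
transitivity (\sum_a list_sum k (fun t => (sgn t)%:C *
    ((eta S a)%:C * B (e a) (e a :: mapf t) * w (mapf t)))); last first.
  rewrite -list_sum_sum; apply: eq_list_sum => t Ht.
  by rewrite -mulr_sumr -mulr_suml.
(* The entry at position [i] is paired with [e a] by the metric, so by orthonormality only the index
   [a] itself remains. *)
apply: eq_bigr => a _; rewrite (list_sum_insert _ ik) (bigD1 a) //=.
rewrite [X in _ + X]big1 ?addr0 => [|b ba].
  apply: eq_list_sum => t Ht.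
  rewrite sign_prod_cons sign_prod_insert cat_take_drop.
  have si : size (mapf (take i t)) = i by rewrite size_map size_takel // Ht.
  rewrite map_cat /= nth_cat si ltnn subnn /= take_size_cat //.
  rewrite (altform_move _ _ _ (HB _)) si.
  rewrite -cat_rcons drop_size_cat ?size_rcons ?si // -map_cat cat_take_drop.
  rewrite frame_orth eqxx [eta S a * _]mulrA eta_sqr mul1r; congr (_ * _).
  by rewrite -!mulrA mulrCA signrMK mulrCA.
rewrite -[RHS](@list_sum0 'I_n _ k); apply: eq_list_sum => t Ht.
have si : size (mapf (take i t)) = i by rewrite size_map size_takel // Ht.
rewrite map_cat /= nth_cat si ltnn subnn /= frame_orth eq_sym (negbTE ba).
by rewrite mulr0 mul0r !mulr0.
Qed.

End Pairing.

Section Hook.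
Variables (R : realType) (n : nat) (M : manifold R n) (g : metric M).
Variables (S : spinor_bundle g) (k : nat).
Local Notation V := 'rV[R]_n.
Local Notation K := R[i].
Variable B : M -> V -> seq V -> K.
Local Notation tr x := (trace1 (eta S) (frame S x x)).
Hypothesis HB : is_form1 k B.

Lemma form1_alternate_altform x : is_altform k.+1%:Z (alternate (B x)).
Proof.
rewrite intS addrC; apply: alternate_altform; first exact: form1_alt HB x.
by move=> a u v t; apply: form1_linear HB x a u v t.
Qed.

Lemma form1_trace_altform x : is_altform (k%:Z - 1) (tr x (B x)).
Proof. by apply: trace1_altform => u; apply: form1_alt HB x u. Qed.

(** The orthogonal complement of an image is the kernel of the adjoint map. Passing from the
    pairings to the kernel uses non-degeneracy on (k+1)-forms and on (k-1)-forms. *)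
Lemma hookP : is_hook S k B <->
  (forall x s, alternate (B x) s = 0) /\ (forall x s, tr x (B x) s = 0).
Proof.
have fact0 j : (j`!%:R : K)^-1 != 0.
  by rewrite invr_eq0 pnatr_eq0 -lt0n fact_gt0.
split=> [[_ H1 H2]|[H1 H2]].
  split=> x.
    apply: (altform_nondegenerate (eta_sqr S) (frame_orth S x)
      (form1_alternate_altform x)) => w Hw.
    have Hw' : is_altform (k%:Z + 1) w by rewrite addrC -intS.
    have /eqP := form1_inner_contract S x (B x) Hw'.
    by rewrite H1 // mulr0 eq_sym mulf_eq0 (negbTE (fact0 k)) => /eqP.
  have := form1_trace_altform x; have BA := form1_alt HB x.
  (* For k = 0 the trace has degree -1 and vanishes for that reason alone. *)
  case: (k) BA (H2 x) => [|j] BA {}H2 HT s.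
    by rewrite (alt_degree HT).
  have E : j.+1%:Z - 1 = j by rewrite intS addrC addKr.
  rewrite E in H2 HT.
  apply: (altform_nondegenerate (eta_sqr S) (frame_orth S x) HT) => w Hw.
  have /eqP := form1_inner_wedge S x w BA.
  by rewrite H2 // eq_sym mulf_eq0 (negbTE (fact0 j)) => /eqP.
split=> // x w Hw.
  apply: (mulfI (_ : k.+1%:R != 0)); first by rewrite pnatr_eq0.
  rewrite (form1_inner_contract S x (B x) Hw) (_ : list_sum _ _ = 0) ?mulr0 //.
  rewrite -[RHS](@list_sum0 'I_n _ k.+1); apply: eq_list_sum => t _.
  by rewrite H1 mul0r mulr0.
have BA := form1_alt HB x.
case: (k) BA Hw (H2 x) => [|j] BA Hw {}H2.
  rewrite form1_innerE big1 ?mulr0 // => a _ /=.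
  by rewrite /wedge big_ord0 !mulr0.
rewrite (form1_inner_wedge S x w BA) (_ : list_sum _ _ = 0) ?mulr0 //.
rewrite -[RHS](@list_sum0 'I_n _ j); apply: eq_list_sum => t _.
by rewrite H2 mul0r mulr0.
Qed.
End Hook.

(** * Clifford multiplication of forms *)

Lemma conj_anticomm (K : comUnitRingType) m (T A B : 'M[K]_m) (a : K) :
  T \in unitmx -> A *m B + B *m A = a%:M ->
  (invmx T *m A *m T) *m (invmx T *m B *m T) +
  (invmx T *m B *m T) *m (invmx T *m A *m T) = a%:M.
Proof.
move=> Tu E; rewrite !mulmxA !(mulmxK Tu) -mulmxDl -!(mulmxA (invmx T)).
by rewrite -mulmxDr E -mulmxA mul_scalar_mx -scalemxAr mulVmx // scalemx1.
Qed.

Section Clifford.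
Variables (R : realType) (n : nat) (M : manifold R n) (g : metric M).
Variables (S : spinor_bundle g) (x : M).
Local Notation V := 'rV[R]_n.
Local Notation K := R[i].
Local Notation N := (2 ^ n./2)%N.
Local Notation h := (inner g x).
Local Notation e := (frame S x x).
Local Notation mapf t := [seq frame S x x a | a <- t].
Local Notation sgn := (sign_prod (eta S)).
Local Notation c := (clif S x).
Implicit Types (w : seq V -> K) (B : V -> seq V -> K).

Lemma clif_sum (I : finType) (a : I -> R) (f : I -> V) :
  c (\sum_i a i *: f i) = \sum_i (a i)%:C *: c (f i).
Proof.
have c0 : c 0 = 0.
  have /eqP := clif_linear S x 1 0 0.
  by rewrite scale1r addr0 scale1r -subr_eq subrr eq_sym => /eqP.
elim/big_ind2: _ => [//|t1 u1 t2 u2 <- <-|i _].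
  by rewrite -[u1]scale1r clif_linear !scale1r.
by rewrite -[_ *: _]addr0 clif_linear c0 addr0.
Qed.

Lemma clif_expand u : c u = \sum_a (eta S a * h (e a) u)%:C *: c (e a).
Proof.
by rewrite {1}(frame_expand (eta_sqr S) (frame_orth S x) u) clif_sum.
Qed.

Lemma clif_frame_conj a :
  c (e a) = invmx (triv S x x) *m sgamma S a *m triv S x x.
Proof.
have xx := sdom_mem S x; have Tu := triv_unit xx.
by rewrite -mulmxA -(clif_frame a xx) mulKmx.
Qed.

Lemma clif_anticomm_frame a b :
  c (e a) *m c (e b) + c (e b) *m c (e a) = (- 2 * h (e a) (e b))%:C%:M.
Proof.
rewrite !clif_frame_conj frame_orth.
rewrite (conj_anticomm (triv_unit (sdom_mem S x)) (sgamma_clifford S a b)).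
case: eqP => _; last by rewrite mulr0.
by rewrite mulNr [in RHS]rmorphN.
Qed.

Lemma clif_anticomm a u :
  c (e a) *m c u + c u *m c (e a) = (- 2 * h (e a) u)%:C%:M.
Proof.
rewrite (clif_expand u) mulmx_sumr mulmx_suml -big_split /=.
under eq_bigr => b _.
  rewrite -scalemxAr -scalemxAl -scalerDr clif_anticomm_frame.
  rewrite scale_scalar_mx -rmorphM; over.
rewrite -!raddf_sum /=; congr (_%:C%:M).
rewrite (bigD1 a) //= big1 ?addr0 => [|b ba].
  rewrite frame_orth eqxx mulrCA; congr (_ * _).
  by rewrite mulrAC eta_sqr mul1r.
by rewrite [h (e a) _]frame_orth eq_sym (negbTE ba) !mulr0.
Qed.

Definition gamma_prod (t : seq 'I_n) : 'M[K]_N := \prod_(a <- t) c (e a).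

Lemma gamma_prod_cat t1 t2 :
  gamma_prod (t1 ++ t2) = gamma_prod t1 *m gamma_prod t2.
Proof. exact: big_cat. Qed.

Lemma gamma_prod_cons a t : gamma_prod (a :: t) = c (e a) *m gamma_prod t.
Proof. exact: big_cons. Qed.

Lemma gamma_prod_rcons a t : gamma_prod (rcons t a) = gamma_prod t *m c (e a).
Proof. by rewrite -cats1 gamma_prod_cat /gamma_prod big_seq1. Qed.

(** The endomorphism of [w] without the factor 1/k! and with plain products in place of
    skew-symmetrized ones, so that single factors can be moved. *)
Definition endo_sum k w : 'M[K]_N :=
  list_sum k (fun t => ((sgn t)%:C * w (mapf t)) *: gamma_prod t).

(** Since the coefficients of [w] are already alternating, skew-symmetrizing the gammas changes
    nothing: reindexing by a permutation produces its sign a second time. *)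
Lemma form_endoE (k : nat) w : is_altform k%:Z w ->
  form_endo S x k w = (k`!%:R)^-1 *: endo_sum k w.
Proof.
move=> Hw; congr (_ *: _); rewrite /endo_sum -big_ffun_list_sum.
pose cf (m : {ffun 'I_k -> 'I_n}) : K :=
  (\prod_i eta S (m i))%:C * w [seq e (m i) | i <- enum 'I_k].
pose gp (m : {ffun 'I_k -> 'I_n}) := \prod_(i < k) c (e (m i)).
rewrite [RHS](_ : _ = \sum_m cf m *: gp m); last first.
  apply: eq_bigr => m _; rewrite /cf /gp.
  rewrite (_ : \prod_i eta S (m i) = sgn [seq m i | i <- enum 'I_k]).
    rewrite (_ : \prod_i _ = gamma_prod [seq m i | i <- enum 'I_k]).
      by rewrite -(map_comp (fun a => e a) m).
    by rewrite /gamma_prod big_map [index_enum _]unlock enumT.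
  by rewrite /sign_prod big_map [index_enum _]unlock enumT.
rewrite /gamma_skew; under eq_bigr do rewrite scalerA mulrC -scalerA scaler_sumr.
rewrite -scaler_sumr exchange_big /=.
(* Every permutation contributes the same sum, and their number k! cancels the weight of
   [gamma_skew]. *)
rewrite (eq_bigr (fun=> \sum_m cf m *: gp m)) => [|s _].
  rewrite sumr_const card_Sn -[X in _ *: X]scaler_nat scalerA mulVf ?scale1r //.
  by rewrite pnatr_eq0 -lt0n fact_gt0.
pose ms (m : {ffun 'I_k -> 'I_n}) := [ffun i => m ((s^-1)%g i)].
rewrite (reindex_inj (h := ms)) /=; last first.
  move=> m m' /ffunP E; apply/ffunP => i.
  by have := E (s i); rewrite !ffunE permK.
apply: eq_bigr => m _; rewrite scalerA; congr (_ *: _); last first.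
  by apply: eq_bigr => i _; rewrite ffunE permK.
rewrite -mulrA; congr (_ * _).
  congr (_%:C); rewrite (reindex_inj (@perm_inj _ s)) /=.
  by apply: eq_bigr => i _; rewrite ffunE permK.
rewrite (eq_map (g := fun i => e (m ((s^-1)%g i)))); last first.
  by move=> i; rewrite ffunE.
rewrite (altform_perm (fun i => e (m i)) _ Hw); first last.
- by move=> i; rewrite mem_enum.
- exact: enum_uniq.
by rewrite odd_permV mulrC signrMK.
Qed.


Section Multiplication.
Variables (u : V) (k : nat) (w : seq V -> K).

(* [c u] is moved through the product of gammas one factor at a time. *)
Definition inserted_endo i : 'M[K]_N :=
  list_sum k (fun t => ((sgn t)%:C * w (mapf t)) *:
    (gamma_prod (take i t) *m c u *m gamma_prod (drop i t))).

Lemma inserted_endo0 : inserted_endo 0 = c u *m endo_sum k w.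
Proof.
rewrite [RHS](raddf_list_sum (mulmx (c u))); apply: eq_list_sum => t _.
by rewrite take0 drop0 /= -scalemxAr [gamma_prod [::]]big_nil mul1mx.
Qed.

Lemma inserted_endo_size : inserted_endo k = endo_sum k w *m c u.
Proof.
rewrite [RHS](raddf_list_sum (mulmxr (c u))); apply: eq_list_sum => t Ht.
by rewrite -Ht take_size drop_size /= -scalemxAl [gamma_prod [::]]big_nil mulmx1.
Qed.

(** The i-th term of the exterior product has g(u, -) in slot [i]. Summing this slot over the frame
    assembles [c u] at position [i] of the product. *)
Lemma endo_sum_wedge :
  endo_sum k.+1 (wedge g x u w) = \sum_(i < k.+1) (-1) ^+ i *: inserted_endo i.
Proof.
transitivity (list_sum k.+1 (fun t => \sum_(i < k.+1) ((sgn t)%:C *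
    ((-1) ^+ i * (h u (nth 0 (mapf t) i))%:C *
      w (take i (mapf t) ++ drop i.+1 (mapf t)))) *: gamma_prod t)).
  apply: eq_list_sum => t Ht; rewrite -scaler_suml -mulr_sumr.
  by rewrite /wedge size_map Ht.
rewrite list_sum_sum; apply: eq_bigr => i _.
have ik : (i <= k)%N by rewrite -ltnS.
rewrite (list_sum_insert _ ik) -list_sum_sum.
rewrite [RHS](raddf_list_sum (GRing.scale ((-1) ^+ i))).
apply: eq_list_sum => t Ht; rewrite clif_expand mulmx_sumr mulmx_suml /= !scaler_sumr.
apply: eq_bigr => a _.
have si : size (mapf (take i t)) = i by rewrite size_map size_takel // Ht.
rewrite sign_prod_insert cat_take_drop gamma_prod_cat gamma_prod_cons.
rewrite map_cat /= nth_cat si ltnn subnn /= take_size_cat //.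
rewrite -cat_rcons drop_size_cat ?size_rcons ?si // -map_cat cat_take_drop.
rewrite -scalemxAr -scalemxAl !scalerA mulmxA inner_sym; congr (_ *: _).
by rewrite !rmorphM /=; ring.
Qed.

End Multiplication.

(** The anticommutator of [c u] with the factor at position [i] is a scalar, which contracts slot
    [i] of [w] with [u]. Moving that slot to the front gives the sign. *)
Lemma inserted_endoS u (k : nat) w i : is_altform k.+1%:Z w -> (i <= k)%N ->
  inserted_endo u k.+1 w i + inserted_endo u k.+1 w i.+1 =
  - (2 * (-1) ^+ i) *: endo_sum k (contract u w).
Proof.
move=> Hw ik; rewrite /inserted_endo !(list_sum_insert _ ik) -!list_sum_sum.
rewrite -list_sumD [RHS](raddf_list_sum (GRing.scale _)).
apply: eq_list_sum => t Ht; rewrite -big_split /= /contract.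
rewrite (altform_expand (eta_sqr S) (frame_orth S x) _ _ Hw) mulr_sumr scaler_suml.
rewrite scaler_sumr; apply: eq_bigr => a _.
have si : size (take i t) = i by rewrite size_takel // Ht.
rewrite sign_prod_insert cat_take_drop map_cat /= (altform_move _ _ _ Hw).
rewrite size_map si -map_cat cat_take_drop -scalerDr.
rewrite (take_size_cat _ si) (drop_size_cat _ si) gamma_prod_cons.
rewrite -cat_rcons take_size_cat ?size_rcons ?si // drop_size_cat ?size_rcons ?si //.
rewrite gamma_prod_rcons -!mulmxA -mulmxDr !mulmxA -mulmxDl addrC clif_anticomm.
rewrite mul_scalar_mx -scalemxAr -gamma_prod_cat cat_take_drop !scalerA.
by congr (_ *: _); rewrite !rmorphM rmorphN /= rmorphMn rmorph1; ring.
Qed.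

Lemma signed_inserted_endo u (k : nat) w i : is_altform k.+1%:Z w ->
  (i <= k.+1)%N ->
  (-1) ^+ i *: inserted_endo u k.+1 w i =
  c u *m endo_sum k.+1 w + (2 * i%:R) *: endo_sum k (contract u w).
Proof.
move=> Hw; elim: i => [|i IH] ik.
  by rewrite expr0 scale1r inserted_endo0 mulr0 scale0r addr0.
rewrite [inserted_endo _ _ _ _](_ : _ = - (2 * (-1) ^+ i) *:
    endo_sum k (contract u w) - inserted_endo u k.+1 w i); last first.
  by rewrite -(inserted_endoS u Hw ik) addrAC subrr add0r.
rewrite exprS mulN1r scaleNr scalerBr IH ?(ltnW ik) // scalerA.
rewrite mulrN mulrCA -expr2 sqrr_sign mulr1 opprB scaleNr opprK -addrA -scalerDl.
by rewrite -[i.+1%:R]natr1 mulrDr mulr1.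
Qed.

Lemma natr_fact_neq0 k : (k`!%:R : K) != 0.
Proof. by rewrite pnatr_eq0 -lt0n fact_gt0. Qed.

Lemma endo_sumE (k : nat) w : is_altform k%:Z w ->
  endo_sum k w = k`!%:R *: form_endo S x k w.
Proof.
by move=> Hw; rewrite form_endoE // scalerA mulfV ?scale1r // natr_fact_neq0.
Qed.

Lemma contract_altformS (k : nat) u w : is_altform k.+1%:Z w ->
  is_altform k%:Z (contract u w).
Proof. by move/(contract_altform u); rewrite intS addrC addKr. Qed.

Lemma wedge_altformS (k : nat) u w : is_altform k%:Z w ->
  is_altform k.+1%:Z (wedge g x u w).
Proof. by move/(wedge_altform g x u); rewrite intS addrC. Qed.

Lemma form_endo0 k : form_endo S x k (fun=> 0) = 0.
Proof. by rewrite /form_endo big1 ?scaler0 // => m _; rewrite mulr0 scale0r. Qed.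

Lemma contract_altform0 u w : is_altform 0 w -> contract u w = fun=> 0.
Proof. by move=> Hw; apply: funext => s; apply: (alt_degree Hw). Qed.

(** In [endo_sum_wedge] every insertion is moved back to the left end, collecting one contraction
    per factor passed. At k = 0 the index [k.-1] is 0 instead of -1, but the contraction is then the
    zero function. *)
Lemma clif_form_endo u (k : nat) w : is_altform k%:Z w ->
  c u *m form_endo S x k w =
  form_endo S x k.+1 (wedge g x u w) - form_endo S x k.-1 (contract u w).
Proof.
move=> Hw; apply: (scalerI (natr_fact_neq0 k.+1)); rewrite scalerBr.
rewrite -endo_sumE; last exact: wedge_altformS.
case: k Hw => [|k] Hw /=.
  rewrite (contract_altform0 _ Hw) form_endo0 scaler0 subr0 scale1r.
  by rewrite endo_sum_wedge big_ord1 expr0 scale1r inserted_endo0 endo_sumE // scale1r.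
have -> : endo_sum k.+2 (wedge g x u w) = k.+2%:R *: (c u *m endo_sum k.+1 w)
    + k.+2%:R *: (k.+1%:R *: endo_sum k (contract u w)).
  rewrite endo_sum_wedge; transitivity (\sum_(i < k.+2) (c u *m endo_sum k.+1 w
      + (2 * i%:R) *: endo_sum k (contract u w))).
    by apply: eq_bigr => i _; rewrite signed_inserted_endo // -ltnS.
  rewrite big_split sumr_const card_ord -scaler_nat -scaler_suml scalerA.
  (* The sum of 2i over i < k + 2 is (k + 2)(k + 1), which completes k! to (k + 2)!. *)
  congr (_ + _ *: _); rewrite -mulr_sumr -natr_sum -!natrM; congr (_%:R).
  elim: k {Hw} => [|k IH]; first by rewrite !big_ord_recr big_ord0.
  by rewrite big_ord_recr mulnDr /= IH mulnC -mulnDl addn2.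
have Hc := contract_altformS u Hw; rewrite !endo_sumE //.
move: (form_endo S x k.+1 w) (form_endo S x k _) => P Q.
rewrite -scalemxAr !scalerA -!natrM [(k.+2)`!]factS [(k.+1)`!]factS mulnA.
by rewrite addrK.
Qed.

Lemma form_endo_clif u (k : nat) w : is_altform k%:Z w ->
  form_endo S x k w *m c u = (-1) ^+ k *:
  (form_endo S x k.+1 (wedge g x u w) + form_endo S x k.-1 (contract u w)).
Proof.
(* Eliminating the exterior product leaves [c u] times the endomorphism plus twice the contraction,
   which is what carrying [c u] through all factors gives. *)
move=> Hw; have /eqP := clif_form_endo u Hw; rewrite eq_sym subr_eq => /eqP ->.
have -> : c u *m form_endo S x k w + form_endo S x k.-1 (contract u w) +
    form_endo S x k.-1 (contract u w) =
    c u *m form_endo S x k w + 2 *: form_endo S x k.-1 (contract u w).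
  by rewrite -addrA -mulr2n scaler_nat.
case: k Hw => [|k] Hw /=.
  rewrite (contract_altform0 _ Hw) form_endo0 scaler0 addr0 expr0 scale1r.
  have := inserted_endo_size u 0 w; rewrite inserted_endo0 !endo_sumE //.
  by rewrite !scale1r.
have Hc := contract_altformS u Hw.
have := signed_inserted_endo u Hw (leqnn _).
rewrite inserted_endo_size !endo_sumE //.
move: (form_endo S x k.+1 w) (form_endo S x k _) => P Q.
move/(congr1 (GRing.scale ((-1) ^+ k.+1))); rewrite scalerA -expr2 sqrr_sign scale1r.
rewrite scalerA -!natrM -mulnA -factS natrM -scalemxAl -scalemxAr mulrC -scalerA.
rewrite -scalerDr scalerA mulrC -scalerA => /(scalerI (natr_fact_neq0 _)) ->.
by [].
Qed.

(** Multiplying by [c u] from the left makes the endomorphisms of u /\ w and u _| w equal, from the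
    right opposite, so that of u _| w vanishes and induction applies. A 0-form gives a multiple of
    the identity of a matrix algebra of positive size. *)
Lemma form_endo_inj (k : nat) w : is_altform k%:Z w ->
  form_endo S x k w = 0 -> forall s, w s = 0.
Proof.
elim: k w => [|k IH] w Hw E s.
  case: s => [|u s]; last by rewrite (alt_degree Hw).
  have /eqP := E; rewrite form_endoE // invr1 scale1r /endo_sum /=.
  rewrite /sign_prod /gamma_prod !big_nil mul1r scaler_eq0 => /orP[/eqP //|].
  rewrite -[1]/(1%:M) => /eqP/matrixP.
  have N0 : (0 < N)%N by rewrite expn_gt0.
  by move/(_ (Ordinal N0) (Ordinal N0)) => /eqP; rewrite !mxE eqxx oner_eq0.
case: s => [|u s]; first by rewrite (alt_degree Hw).
rewrite -[w _]/(contract u w s); apply: IH; first exact: contract_altformS.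
have /eqP := clif_form_endo u Hw; rewrite E mulmx0 eq_sym subr_eq0 => /eqP E1.
have /eqP := form_endo_clif u Hw; rewrite E mul0mx E1 -mulr2n -scaler_nat scalerA.
by rewrite eq_sym scaler_eq0 mulf_eq0 signr_eq0 pnatr_eq0 => /eqP.
Qed.

Lemma form_endo_linear k (a : K) w w' :
  form_endo S x k (fun s => a * w s + w' s) =
  a *: form_endo S x k w + form_endo S x k w'.
Proof.
rewrite /form_endo [a *: _]scalerA [a * _]mulrC -[(_ * a) *: _]scalerA -scalerDr.
congr (_ *: _); rewrite scaler_sumr -big_split; apply: eq_bigr => m _ /=.
by rewrite mulrDr scalerDl scalerA mulrCA.
Qed.

End Clifford.

(** * Signs, charge conjugation and skewness *)

Section Signs.
Variable Delta : int -> int.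
Hypothesis Delta_sign : forall k, Delta k = 1 \/ Delta k = -1.
Hypothesis DeltaE : forall k : int, Delta k =
  (-1) ^ (k * (k - 1) %/ 2)%Z * Delta 0 ^ (k + 1) * Delta 1 ^ k.

Lemma sign_unit (d : int) : d = 1 \/ d = -1 -> d \is a GRing.unit.
Proof. by case=> ->. Qed.

Lemma sign_exprz2 (d m : int) : d = 1 \/ d = -1 -> d ^ (2 * m) = 1.
Proof.
by move=> Hd; rewrite -exprz_exp; case: Hd => ->; rewrite ?exp1rz // exp1rz.
Qed.

Lemma sign_periodic (d m k : int) : d = 1 \/ d = -1 -> d ^ (2 * m + k) = d ^ k.
Proof. by move=> Hd; rewrite exprzDr ?sign_unit // sign_exprz2 // mul1r. Qed.

Lemma Delta_periodic q k : Delta (q * 4 + k) = Delta k.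
Proof.
have s1 : (-1 : int) = 1 \/ (-1 : int) = -1 by right.
rewrite DeltaE [RHS]DeltaE.
have -> : (q * 4 + k) * (q * 4 + k - 1) =
    (8 * q * q + 4 * q * k - 2 * q) * 2 + k * (k - 1) by ring.
rewrite divzMDl //.
have -> : 8 * q * q + 4 * q * k - 2 * q = 2 * (4 * q * q + 2 * q * k - q) by ring.
have -> : q * 4 + k + 1 = 2 * (2 * q) + (k + 1) by ring.
have -> : q * 4 + k = 2 * (2 * q) + k by ring.
by rewrite !sign_periodic.
Qed.

(** All three conditions depend only on the residue of [deg] modulo 4 and on the signs [Delta 0] and
    [Delta 1]. The sixteen cases are settled by computation. *)
Lemma sign_condition (deg : int) :
  (Delta 1 * Delta deg = -1 <-> Delta 0 * Delta (deg - 1) = (-1) ^ deg) /\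
  (Delta 0 * Delta (deg - 1) = (-1) ^ deg <->
   (deg = 3 %[mod 4])%Z \/ (deg = 1 + Delta 0 * Delta 1 %[mod 4])%Z).
Proof.
have s1 : (-1 : int) = 1 \/ (-1 : int) = -1 by right.
rewrite (divz_eq deg 4); set q := (deg %/ 4)%Z.
have : (0 <= deg %% 4)%Z && (deg %% 4 < 4)%Z by rewrite modz_ge0 // ltz_mod.
case: (deg %% 4)%Z => // r /= r4.
rewrite -[_ + _ - 1]addrA !Delta_periodic !modzMDl.
rewrite (_ : q * 4 = 2 * (2 * q)); last by ring.
rewrite sign_periodic //.
have HE := DeltaE.
case: (Delta_sign 0) (Delta_sign 1) => E0 [] E1; rewrite E0 E1 in HE *;
  rewrite !HE; case: r r4 => [|[|[|[|r]]]] // _.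
all: vm_compute; intuition congruence.
Qed.

(** Raising k by 2 adds the odd number 2k + 1 to k(k-1)/2 and leaves the parities of the other
    exponents unchanged. *)
Lemma Delta_sub2 k : Delta (k - 2) = - Delta k.
Proof.
have s1 : (-1 : int) = 1 \/ (-1 : int) = -1 by right.
rewrite -[in RHS](subrK 2 k); move: (k - 2) => {}k.
rewrite DeltaE [in RHS]DeltaE.
rewrite (_ : (k + 2) * (k + 2 - 1) = (2 * k + 1) * 2 + k * (k - 1)); last by ring.
rewrite divzMDl // -addrA sign_periodic // [(-1) ^ (1 + _)]exprzDr ?sign_unit // expr1z.
rewrite (_ : k + 2 + 1 = 2 * 1 + (k + 1)); last by ring.
rewrite [k + 2]addrC -[X in X + k]mulr1 !sign_periodic //.
by rewrite mulN1r !mulNr opprK.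
Qed.
End Signs.

Section ChargeAdjoint.
Variables (R : realType) (n : nat) (M : manifold R n) (g : metric M).
Variables (S : spinor_bundle g) (C : charge_conjugation S) (Delta : int -> int).
Hypothesis HDelta : is_charge_signs C Delta.
Local Notation K := R[i].
Local Notation N := (2 ^ n./2)%N.

Lemma cform_symm x (E : 'M[K]_N) (d : K) :
  (forall phi psi, cform C x phi (E *m psi) = d * cform C x psi (E *m phi)) ->
  (charge_mx C x *m E)^T = d *: (charge_mx C x *m E).
Proof.
move=> H; apply/matrixP => i j; rewrite [LHS]mxE [RHS]mxE.
have cE k l : cform C x (delta_mx k 0) (E *m delta_mx l 0) =
    (charge_mx C x *m E) k l.
  rewrite /cform trmx_delta mulmxA -[_ *m _ *m E]mulmxA -rowE -colE.
  by rewrite mxE mxE.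
by have := H (delta_mx j 0) (delta_mx i 0); rewrite !cE.
Qed.

Lemma cform_gamma_skew x (k : nat) (m : 'I_k -> 'I_n) : (k <= n)%N ->
  (charge_mx C x *m gamma_skew S x (fun i => frame S x x (m i)))^T =
  (Delta k%:Z)%:~R *: (charge_mx C x *m gamma_skew S x (fun i => frame S x x (m i))).
Proof.
by case: HDelta => _ H _ kn; apply: cform_symm => phi psi; apply: H.
Qed.

Lemma charge_mx_symm x : (charge_mx C x)^T = (Delta 0)%:~R *: charge_mx C x.
Proof.
(* In degree 0 the skew-symmetrized product is the identity; the index map is the empty one. *)
have := @cform_gamma_skew x 0 (fun i => False_rect _ (notF (ltn_ord i))) (leq0n n).
rewrite (_ : gamma_skew S x _ = 1%:M) ?mulmx1 // /gamma_skew.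
rewrite (eq_bigr (fun=> 1)) => [|s _].
  by rewrite sumr_const card_Sn invr1 scale1r.
have -> : s = 1%g by apply/permP => -[].
by rewrite big_ord0 odd_perm1 expr0 scale1r.
Qed.

Lemma charge_form_endo x (k : nat) w : (k <= n)%N ->
  (charge_mx C x *m form_endo S x k w)^T =
  (Delta k%:Z)%:~R *: (charge_mx C x *m form_endo S x k w).
Proof.
move=> kn; rewrite /form_endo -scalemxAr linearZ /= scalerA mulrC -scalerA.
congr (_ *: _); rewrite mulmx_sumr raddf_sum scaler_sumr; apply: eq_bigr => m _.
by rewrite /= -scalemxAr linearZ /= cform_gamma_skew // !scalerA mulrC.
Qed.

(** Transposing the product of the charge matrix with the endomorphism gives [Delta k], transposing
    the inverse charge matrix gives [Delta 0], which is its own inverse. *)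
Lemma charge_adj_form_endo x (k : nat) w : (k <= n)%N ->
  charge_adj C x (form_endo S x k w) =
  (Delta 0 * Delta k%:Z)%:~R *: form_endo S x k w.
Proof.
move=> kn; rewrite /charge_adj trmx_mul charge_form_endo // trmx_inv.
rewrite charge_mx_symm -scalemxAr.
have Cu := charge_mx_unit C x.
have [s0 _ _] := HDelta; have d0 : ((Delta 0)%:~R : K) \is a GRing.unit.
  by case: (s0 0) => ->; rewrite ?unitrN1 ?unitr1.
rewrite invmxZ ?unitmxZ // -scalemxAl mulKmx // scalerA mulrC rmorphM.
by case: (s0 0) => ->; rewrite ?invr1 // rmorphN invrN1.
Qed.

End ChargeAdjoint.

(** * Consequences of skewness for the exterior and interior products *)

Section SymmetricPart.
Variables (R : realType) (n : nat) (M : manifold R n) (g : metric M).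
Variables (S : spinor_bundle g) (x : M) (l : nat).
Local Notation V := 'rV[R]_n.
Local Notation K := R[i].
Local Notation h := (inner g x).
Local Notation e := (frame S x x).
Variable B : V -> seq V -> K.
Hypothesis HB : forall u, is_altform l%:Z (B u).
Hypothesis LB : forall a u v t, B (a *: u + v) t = a%:C * B u t + B v t.
Local Notation tr := (trace1 (eta S) e).

(** The hypothesis for [e a] and [v] is evaluated on [e a :: s], weighted by eta_a and summed. The
    first term gives (n - l) B_v by [trace1_wedge], the second B_v - v /\ tr B by
    [contract_wedge]. *)
Lemma wedge_symm_eq0 :
    (forall u v s, wedge g x u (B v) s + wedge g x v (B u) s = 0) ->
  forall v s, (n%:R - l%:R + 1) * B v s = wedge g x v (tr B) s.
Proof.
move=> H v s; have [Hs|Hs] := eqVneq (size s) l; last first.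
  have Ht := wedge_altform g x v (trace1_altform (eta S) e HB).
  rewrite (alt_degree (HB v)) ?mulr0; last by case=> E; rewrite E eqxx in Hs.
  by rewrite (alt_degree Ht) // subrK; case=> E; rewrite E eqxx in Hs.
have E1 := trace1_wedge (eta_sqr S) (frame_orth S x) s (HB v).
have E2 : \sum_a (eta S a * h (e a) v)%:C * B (e a) s = B v s.
  by rewrite [RHS](linear_expand (eta_sqr S) (frame_orth S x) LB).
rewrite mulrDl mul1r -Hs -E1 -[in X in _ + X]E2 wedge_trace1 /trace1 -big_split /=.
apply/eqP; rewrite -subr_eq0 -sumrB big1 // => a _.
have := H (e a) v (e a :: s); rewrite -[wedge g x v _ _]/(contract (e a) _ s).
rewrite contract_wedge => /(congr1 (fun z => (eta S a)%:C * z)).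
by rewrite mulr0 => <-; rewrite rmorphM inner_sym /=; ring.
Qed.

(** Exchanging the Omega^1 slot with the first form slot changes the sign, so each of the l + 1
    terms of the alternation equals B_v(s). *)
Lemma contract_symm_eq0 :
    (forall u v s, B v (u :: s) = - B u (v :: s)) ->
  forall v s, l.+1%:R * B v s = alternate B (v :: s).
Proof.
move=> H v s; have [Hs|Hs] := eqVneq (size s) l; last first.
  have Ha := alternate_altform HB LB.
  rewrite (alt_degree (HB v)) ?mulr0; last by case=> E; rewrite E eqxx in Hs.
  by rewrite (alt_degree Ha) // /= intS addrC => /addIr [E]; rewrite E eqxx in Hs.
rewrite alternate_cons -Hs -natr1 mulrDl mul1r addrC; congr (_ + _).
rewrite -(alternate_contract _ (HB v)) -alternateN; apply: eq_alternate => u t.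
exact: H.
Qed.

End SymmetricPart.

(** * Smooth functions *)

Section NearEq.
Local Open Scope classical_set_scope.

Lemma near_eq_differentiable (K : numFieldType) (V W : normedModType K)
    (f g : V -> W) (x : V) :
  (\near x, f x = g x) -> differentiable f x -> differentiable g x.
Proof.
move=> fg df; have fgx : f x = g x by apply: nbhs_singleton fg.
have Ef := diff_locally df.
have Eg : g \o shift x = cst (g x) + 'd f x +o_ 0 id.
  apply/eqaddoP => eps e0; move/eqaddoP: Ef => /(_ eps e0).
  have fg0 : \forall y \near (0 : V), f (y + x) = g (y + x).
    move: fg; rewrite (near_shift 0) /=.
    by apply: filterS => y; rewrite subr0.
  by apply: filterS2 fg0 => y /= fgy; rewrite !fctE /= /shift /= fgy fgx.
apply/diff_locallyP; rewrite (diff_unique (diff_continuous df) Eg).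
by split=> //; apply: diff_continuous.
Qed.

End NearEq.

Section Ck.
Local Open Scope classical_set_scope.
Variables (R : realType) (n : nat).
Local Notation V := 'rV[R]_n.
Implicit Types (U W : set V) (f g : V -> R).

(** [Ck] on a set imposes conditions point by point on the derivatives of a total function, so it
    may be checked on any sets covering [U]. *)
Lemma Ck_cover k U f :
  (forall x, U x -> exists2 W, W x & Ck k W f) -> Ck k U f.
Proof.
elim: k f => [|k IH] f H /=.
  by move=> x /H[W Wx]; apply.
split=> [x /H[W Wx [+ _]]|v]; first exact.
by apply: IH => x /H[W Wx [_ /(_ v) ?]]; exists W.
Qed.

Lemma open_eq_near U f g x : open U -> {in U, f =1 g} -> U x ->
  \near x, f x = g x.
Proof.
move=> oU E Ux; have := open_nbhs_nbhs (conj oU Ux).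
by apply: filterS => y Uy; apply: E; rewrite inE.
Qed.

Lemma Ck_eq k U f g : open U -> {in U, f =1 g} -> Ck k U f -> Ck k U g.
Proof.
move=> oU; elim: k f g => [|k IH] f g E /= H.
  move=> x Ux; have fgx : f x = g x by apply: E; rewrite inE.
  have fg := open_eq_near oU E Ux.
  rewrite /prop_for /continuous_at -fgx; have fx := H x Ux.
  rewrite /prop_for /continuous_at in fx.
  by apply: cvg_trans fx; apply: (near_eq_cvg fg).
case: H => H1 H2; split=> [x Ux|v]; first by
  apply: near_eq_differentiable (H1 x Ux); apply: open_eq_near Ux.
apply: IH (H2 v) => x; rewrite inE => Ux.
by apply: near_eq_derive; apply: open_eq_near Ux.
Qed.

Lemma Ck_pred k U f : Ck k.+1 U f -> Ck k U f.
Proof.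
elim: k f => [|k IH] f [H1 H2].
  by move=> x Ux; apply: differentiable_continuous; apply: H1.
by split=> // v; apply: IH.
Qed.

Lemma Ck_cst k U (a : R) : Ck k U (fun=> a).
Proof.
elim: k a => [|k IH] a /=; first by move=> x _; apply: cst_continuous.
split=> [x _|v]; first exact: differentiable_cst.
have -> : (fun x : V => 'D_v (fun=> a) x) = (fun=> 0 : R); last exact: IH.
by apply: funext => x; apply: derive_cst.
Qed.

Lemma derive_diffD U f g v : (forall x, U x -> differentiable f x) ->
  (forall x, U x -> differentiable g x) ->
  {in U, (fun x => 'D_v f x + 'D_v g x) =1 (fun x => 'D_v (fun y => f y + g y) x)}.
Proof.
move=> df dg x; rewrite inE => Ux; apply/esym.
by apply: deriveD; apply: diff_derivable; [apply: df | apply: dg].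
Qed.

Lemma derive_diffM U f g v : (forall x, U x -> differentiable f x) ->
  (forall x, U x -> differentiable g x) ->
  {in U, (fun x => f x * 'D_v g x + g x * 'D_v f x)
     =1 (fun x => 'D_v (fun y => f y * g y) x)}.
Proof.
move=> df dg x; rewrite inE => Ux; apply/esym.
by apply: deriveM; apply: diff_derivable; [apply: df | apply: dg].
Qed.

Lemma Ck_add k U f g : open U -> Ck k U f -> Ck k U g ->
  Ck k U (fun x => f x + g x).
Proof.
move=> oU; elim: k f g => [|k IH] f g; first by move=> Hf Hg x Ux;
  exact: (cvgD (Hf x Ux) (Hg x Ux)).
case=> f1 f2 [g1 g2]; split=> [x Ux|v].
  by apply: differentiableD; [apply: f1 | apply: g1].
apply: (Ck_eq oU (derive_diffD v f1 g1)).
exact: IH (f2 v) (g2 v).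
Qed.

Lemma Ck_mul k U f g : open U -> Ck k U f -> Ck k U g ->
  Ck k U (fun x => f x * g x).
Proof.
move=> oU; elim: k f g => [|k IH] f g; first by move=> Hf Hg x Ux;
  exact: (cvgM (Hf x Ux) (Hg x Ux)).
move=> Hf Hg; have [f1 f2] := Hf; have [g1 g2] := Hg; split=> [x Ux|v].
  by apply: differentiableM; [apply: f1 | apply: g1].
apply: (Ck_eq oU (derive_diffM v f1 g1)).
exact: (Ck_add oU (IH _ _ (Ck_pred Hf) (g2 v)) (IH _ _ (Ck_pred Hg) (f2 v))).
Qed.
End Ck.

Section Smooth.
Local Open Scope classical_set_scope.
Variables (R : realType) (n : nat) (M : manifold R n).
Implicit Types (U W : set M) (f g : M -> R) (x : M) (v : 'rV[R]_n).

Lemma chart_image_open U x : open U -> open (chart x @` (U `&` chart_dom x)).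
Proof.
move=> oU; rewrite openE => _ [y [Uy dy] <-].
have Ip : (chart x @` chart_dom x) (chart x y) by exists y.
have Wn : nbhs (chart x y) (chart_inv x @^-1` U).
  apply: (chart_inv_cont Ip); rewrite /= chartK //.
  exact: open_nbhs_nbhs (conj oU Uy).
have In := open_nbhs_nbhs (conj (@chart_img_open _ _ M x) Ip).
apply: filterS2 Wn In => p + Ip2; case: Ip2 => z dz <- /=; rewrite chartK // => Uz.
by exists z.
Qed.

Lemma smooth_cover U f :
  (forall x, U x -> exists2 W, W x & smooth W f) -> smooth U f.
Proof.
move=> H x k; apply: Ck_cover => _ [y [Uy dy] <-].
have [W Wy /(_ x k) HW] := H y Uy.
by exists (chart x @` (W `&` chart_dom x)) => //; exists y.
Qed.

Lemma smooth_eq U f g : open U -> {in U, f =1 g} -> smooth U f -> smooth U g.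
Proof.
move=> oU E H x k; apply: Ck_eq (H x k); first exact: chart_image_open.
move=> p; rewrite inE => -[y [Uy dy] <-].
by rewrite /= chartK // E // inE.
Qed.

Lemma smooth_cst U (a : R) : smooth U (fun=> a).
Proof. by move=> x k; apply: Ck_cst. Qed.

Lemma smooth_add U f g : open U -> smooth U f -> smooth U g ->
  smooth U (fun x => f x + g x).
Proof.
move=> oU Hf Hg x k.
have := Ck_add (@chart_image_open U x oU) (Hf x k) (Hg x k); exact.
Qed.

Lemma smooth_mul U f g : open U -> smooth U f -> smooth U g ->
  smooth U (fun x => f x * g x).
Proof.
move=> oU Hf Hg x k.
have := Ck_mul (@chart_image_open U x oU) (Hf x k) (Hg x k); exact.
Qed.

Lemma smooth_differentiable U f x : smooth U f -> U x ->
  differentiable (f \o chart_inv x) (chart x x).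
Proof.
move=> H Ux; have [H1 _] := H x 1%N; apply: H1.
by exists x => //; split=> //; apply: chart_dom_mem.
Qed.

Lemma der_eq U f g x v : open U -> U x -> {in U, f =1 g} ->
  der x v f = der x v g.
Proof.
move=> oU Ux E; apply: near_eq_derive.
have dx := chart_dom_mem x.
apply: (@open_eq_near _ _ (chart x @` (U `&` chart_dom x))).
- exact: chart_image_open.
- by move=> p; rewrite inE => -[y [Uy dy] <-]; rewrite /= chartK // E // inE.
- by exists x.
Qed.

Section Derivatives.
Variables (U : set M) (x : M).
Hypothesis Ux : U x.

Lemma der_linear f a u v : smooth U f ->
  der x (a *: u + v) f = a * der x u f + der x v f.
Proof.
move=> /smooth_differentiable - /(_ x Ux) df.
by rewrite /der !deriveE // linearD linearZ.
Qed.

Lemma der_cst v (a : R) : der x v (fun=> a) = 0.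
Proof. exact: derive_cst. Qed.

Lemma der_add f g v : smooth U f -> smooth U g ->
  der x v (fun y => f y + g y) = der x v f + der x v g.
Proof.
move=> /smooth_differentiable - /(_ x Ux) df.
move=> /smooth_differentiable - /(_ x Ux) dg.
by apply: deriveD; apply: diff_derivable.
Qed.

Lemma der_mul f g v : smooth U f -> smooth U g ->
  der x v (fun y => f y * g y) = f x * der x v g + g x * der x v f.
Proof.
move=> /smooth_differentiable - /(_ x Ux) df.
move=> /smooth_differentiable - /(_ x Ux) dg.
rewrite /der [LHS]deriveM /= ?chartK //; try exact: chart_dom_mem.
all: exact: diff_derivable.
Qed.

End Derivatives.

Implicit Types (F G : M -> R[i]).

Lemma csmooth_cover U F :
  (forall x, U x -> exists2 W, W x & csmooth W F) -> csmooth U F.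
Proof.
by move=> H; split; apply: smooth_cover => x /H[W Wx [H1 H2]]; exists W.
Qed.

Lemma csmooth_eq U F G : open U -> {in U, F =1 G} -> csmooth U F -> csmooth U G.
Proof.
by move=> oU E [H1 H2]; split; [apply: smooth_eq H1 | apply: smooth_eq H2] => // x Ux;
  rewrite E.
Qed.

Lemma csmooth_cst U (a : R[i]) : csmooth U (fun=> a).
Proof. by split; apply: smooth_cst. Qed.

Lemma csmooth_real U f : smooth U f -> csmooth U (fun x => (f x)%:C).
Proof. by split=> //; apply: smooth_cst. Qed.

Lemma ReD (a b : R[i]) : complex.Re (a + b) = complex.Re a + complex.Re b.
Proof. by case: a b => [? ?] []. Qed.
Lemma ImD (a b : R[i]) : complex.Im (a + b) = complex.Im a + complex.Im b.
Proof. by case: a b => [? ?] []. Qed.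
(** The difference is written with the constant -1 so that [smooth_add] and [smooth_mul] apply to
    it. *)
Lemma ReM (a b : R[i]) : complex.Re (a * b) =
  complex.Re a * complex.Re b + (- 1) * (complex.Im a * complex.Im b).
Proof. by case: a b => [? ?] [? ?] /=; rewrite mulN1r. Qed.
Lemma ImM (a b : R[i]) : complex.Im (a * b) =
  complex.Re a * complex.Im b + complex.Im a * complex.Re b.
Proof. by case: a b => [? ?] [? ?]. Qed.

Lemma csmooth_add U F G : open U -> csmooth U F -> csmooth U G ->
  csmooth U (fun x => F x + G x).
Proof.
move=> oU [F1 F2] [G1 G2]; split.
  by apply: smooth_eq (smooth_add oU F1 G1) => // x _; rewrite ReD.
by apply: smooth_eq (smooth_add oU F2 G2) => // x _; rewrite ImD.
Qed.

Lemma csmooth_mul U F G : open U -> csmooth U F -> csmooth U G ->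
  csmooth U (fun x => F x * G x).
Proof.
move=> oU [F1 F2] [G1 G2]; split.
  have H := smooth_mul oU (smooth_cst U (-1)) (smooth_mul oU F2 G2).
  apply: smooth_eq (smooth_add oU (smooth_mul oU F1 G1) H) => // x _.
  by rewrite ReM.
apply: smooth_eq (smooth_add oU (smooth_mul oU F1 G2) (smooth_mul oU F2 G1)) => //.
by move=> x _; rewrite ImM.
Qed.

Lemma csmooth_sum U (I : Type) (r : seq I) (P : pred I) (F : I -> M -> R[i]) :
  open U -> (forall i, csmooth U (F i)) ->
  csmooth U (fun x => \sum_(i <- r | P i) F i x).
Proof.
move=> oU H; elim: r => [|i r IH].
  by apply: csmooth_eq (csmooth_cst U 0) => // x _; rewrite big_nil.
case Pi: (P i); first apply: csmooth_eq (csmooth_add oU (H i) IH) => //.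
  by move=> x _; rewrite big_cons Pi.
by apply: csmooth_eq IH => // x _; rewrite big_cons Pi.
Qed.

Lemma cder_eq U F G x v : open U -> U x -> {in U, F =1 G} ->
  cder x v F = cder x v G.
Proof.
by move=> oU Ux E; congr Complex; apply: (der_eq v oU Ux) => y Uy; rewrite E.
Qed.

Section ComplexDerivatives.
Variables (U : set M) (x : M).
Hypothesis Ux : U x.

Lemma cder_linear F a u v : csmooth U F ->
  cder x (a *: u + v) F = a%:C * cder x u F + cder x v F.
Proof.
move=> [F1 F2]; rewrite /cder (der_linear Ux _ _ _ F1) (der_linear Ux _ _ _ F2).
by apply/eqP; rewrite eq_complex /= !mul0r subr0 addr0 !eqxx.
Qed.

Lemma cder_cst v a : cder x v (fun=> a) = 0.
Proof. by rewrite /cder !der_cst. Qed.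

Lemma cder_add F G v : csmooth U F -> csmooth U G ->
  cder x v (fun y => F y + G y) = cder x v F + cder x v G.
Proof.
move=> [F1 F2] [G1 G2]; rewrite /cder.
have -> : (fun y => complex.Re (F y + G y)) =
    (fun y => complex.Re (F y) + complex.Re (G y)) by apply: funext => y; rewrite ReD.
have -> : (fun y => complex.Im (F y + G y)) =
    (fun y => complex.Im (F y) + complex.Im (G y)) by apply: funext => y; rewrite ImD.
by rewrite !(der_add Ux).
Qed.

Lemma cder_mul F G v : open U -> csmooth U F -> csmooth U G ->
  cder x v (fun y => F y * G y) = F x * cder x v G + cder x v F * G x.
Proof.
move=> oU [F1 F2] [G1 G2]; rewrite /cder.
have -> : (fun y => complex.Re (F y * G y)) = (fun y => complex.Re (F y) *
    complex.Re (G y) + (- 1) * (complex.Im (F y) * complex.Im (G y))).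
  by apply: funext => y; rewrite ReM.
have -> : (fun y => complex.Im (F y * G y)) = (fun y => complex.Re (F y) *
    complex.Im (G y) + complex.Im (F y) * complex.Re (G y)).
  by apply: funext => y; rewrite ImM.
have c1 := smooth_cst U (- 1).
rewrite !(der_add Ux) ?(der_mul Ux); try by do ?apply: smooth_mul.
rewrite der_cst mulr0 addr0.
apply/eqP; rewrite eq_complex ReD ImD !ReM !ImM /=; apply/andP; split; apply/eqP; ring.
Qed.

Lemma cder_sum (I : Type) (r : seq I) (F : I -> M -> R[i]) v : open U ->
  (forall i, csmooth U (F i)) ->
  cder x v (fun y => \sum_(i <- r) F i y) = \sum_(i <- r) cder x v (F i).
Proof.
move=> oU H; elim: r => [|i r IH].
  rewrite big_nil -[RHS](cder_cst v 0); congr cder.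
  by apply: funext => y; rewrite big_nil.
rewrite big_cons -IH -cder_add //; last exact: csmooth_sum.
by congr cder; apply: funext => y; rewrite big_cons.
Qed.

Lemma cder_real f v : cder x v (fun y => (f y)%:C) = (der x v f)%:C.
Proof. by congr Complex; apply: der_cst. Qed.

End ComplexDerivatives.
End Smooth.

(** * The spin connection *)

Section VectorFields.
Local Open Scope classical_set_scope.
Variables (R : realType) (n : nat) (M : manifold R n).
Implicit Types (U : set M) (X Y : M -> 'rV[R]_n).

Lemma vsmooth_sub U W X : W `<=` U -> vsmooth U X -> vsmooth W X.
Proof. by move=> WU H V f oV VW; apply: H => // y /VW/WU. Qed.

Lemma vsmooth0 U : vsmooth U (fun=> 0 : 'rV[R]_n).
Proof.
move=> V f oV _ Hf; apply: (smooth_eq oV) (smooth_cst V 0) => y; rewrite inE => Vy.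
have /eqP := der_linear Vy 1 0 0 Hf.
by rewrite scale1r addr0 mul1r -subr_eq subrr => /eqP.
Qed.

Lemma vsmooth_linear U a X Y : vsmooth U X -> vsmooth U Y ->
  vsmooth U (fun y => a *: X y + Y y).
Proof.
move=> HX HY V f oV VU Hf.
have H := smooth_add oV (smooth_mul oV (smooth_cst V a) (HX V f oV VU Hf))
  (HY V f oV VU Hf).
by apply: (smooth_eq oV) H => y; rewrite inE => Vy; rewrite (der_linear Vy _ _ _ Hf).
Qed.

Lemma vsmooth_sum U (I : finType) (c : I -> R) (X : I -> M -> 'rV[R]_n) :
  (forall i, vsmooth U (X i)) -> vsmooth U (fun y => \sum_i c i *: X i y).
Proof.
move=> HX; elim: (index_enum I) => [|i r IH].
  have -> : (fun y => \sum_(i <- [::]) c i *: X i y) = (fun=> 0).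
    by apply: funext => y; rewrite big_nil.
  exact: vsmooth0.
have -> : (fun y => \sum_(i <- i :: r) c i *: X i y) =
    (fun y => c i *: X i y + \sum_(i <- r) c i *: X i y).
  by apply: funext => y; rewrite big_cons.
exact: vsmooth_linear.
Qed.

End VectorFields.

Section SpinConnectionAlgebra.
Variables (K : fieldType) (n m : nat) (q : 'I_n -> K) (gam : 'I_n -> 'M[K]_m).
Hypothesis gam_clifford : forall a b, gam a *m gam b + gam b *m gam a =
  (if a == b then - (2 * q a) else 0)%:M.
Hypothesis q2 : forall a, q a * q a = 1.
Hypothesis K4 : (4 : K) != 0.

Lemma gam_commutator a b c :
  gam a *m gam b *m gam c - gam c *m (gam a *m gam b) =
  (if a == c then 2 * q c else 0) *: gam b -
  (if b == c then 2 * q c else 0) *: gam a.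
Proof.
have E a' b' : gam a' *m gam b' =
    (if a' == b' then - (2 * q b') else 0)%:M - gam b' *m gam a'.
  rewrite -[LHS](addrK (gam b' *m gam a')) gam_clifford.
  by congr (_%:M - _); case: eqP => [->|].
rewrite -mulmxA [gam b *m _]E mulmxBr !mulmxA.
have -> : gam c *m gam a = (if a == c then - (2 * q c) else 0)%:M - gam a *m gam c.
  by rewrite E eq_sym; case: eqP => [->|].
rewrite mulmxBl mul_mx_scalar mul_scalar_mx opprB addrA subrK.
by rewrite [RHS]addrC; congr (_ + _); case: eqP => _;
  rewrite ?scaleNr ?opprK ?scale0r ?oppr0.
Qed.

(** The infinitesimal spin representation: the commutator with one quarter of Om gamma gamma acts on
    gammas as the skew matrix Om. By antisymmetry the two halves of the commutator agree and cancel
    the 4. *)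
Lemma gam_connection_commutator (Om : 'I_n -> 'I_n -> K) c :
    (forall a b, Om a b = - Om b a) ->
  let om := 4^-1 *: \sum_a \sum_b (q a * q b * Om a b) *: (gam a *m gam b) in
  om *m gam c - gam c *m om = \sum_b (q b * Om c b) *: gam b.
Proof.
move=> Om_anti om; rewrite /om -scalemxAl -scalemxAr -scalerBr.
rewrite mulmx_suml mulmx_sumr -sumrB.
transitivity (4^-1 *: (\sum_b (2 * (q b * Om c b)) *: gam b +
   \sum_a (2 * (q a * Om c a)) *: gam a)); last first.
  rewrite -big_split scaler_sumr; apply: eq_bigr => b _.
  by rewrite /= -scalerDl scalerA; congr (_ *: _); field.
congr (_ *: _).
transitivity (\sum_a \sum_b (q a * q b * Om a b) *:
  ((if a == c then 2 * q c else 0) *: gam b -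
   (if b == c then 2 * q c else 0) *: gam a)).
  apply: eq_bigr => a _; rewrite mulmx_suml mulmx_sumr -sumrB; apply: eq_bigr => b _.
  by rewrite -scalemxAl -scalemxAr -scalerBr gam_commutator.
under eq_bigr => a _ do under eq_bigr => b _ do rewrite scalerBr !scalerA.
under eq_bigr => a _ do rewrite sumrB.
rewrite sumrB; congr (_ + _).
  rewrite (bigD1 c) //= [X in _ + X]big1 => [|a /negbTE ac].
    rewrite addr0; apply: eq_bigr => b _; rewrite eqxx; congr (_ *: _).
    by rewrite -[RHS]mul1r -(q2 c); ring.
  by rewrite ac big1 // => b _; rewrite mulr0 scale0r.
rewrite -sumrN; apply: eq_bigr => a _.
rewrite (bigD1 c) //= big1 => [|b /negbTE bc]; last by rewrite bc mulr0 scale0r.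
rewrite addr0 eqxx -scaleNr; congr (_ *: _).
by rewrite [Om a c]Om_anti -[RHS]mul1r -(q2 c); ring.
Qed.

End SpinConnectionAlgebra.

Lemma linear_col (K : pzRingType) m (a : K) (f g h : 'I_m -> K) :
  (forall i, h i = a * f i + g i) ->
  \col_i h i = a *: (\col_i f i) + \col_i g i.
Proof. by move=> H; apply/colP => i; rewrite !mxE. Qed.

Section SpinorBundle.
Local Open Scope classical_set_scope.
Variables (R : realType) (n : nat) (M : manifold R n) (g : metric M).
Variable S : spinor_bundle g.
Local Notation K := R[i].
Local Notation N := (2 ^ n./2)%N.
Implicit Types (U : set M) (X Y : M -> 'rV[R]_n) (xi : M -> 'cV[K]_N) (x y z : M).

(** The shape of Clifford multiplication in a trivialization: the matrices are constant, so only the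
    coefficients are differentiated. *)
Definition sgamma_comb (c : 'I_n -> R) : 'M[K]_N := \sum_a (c a)%:C *: sgamma S a.

Lemma triv_clif z y u : sdom S z y ->
  triv S z y *m clif S y u =
  sgamma_comb (fun a => eta S a * inner g y (frame S z y a) u) *m triv S z y.
Proof.
move=> zy; have zorth a b := frame_orthonormal a b zy.
rewrite {1}(frame_expand (eta_sqr S) zorth u).
rewrite clif_sum mulmx_sumr mulmx_suml; apply: eq_bigr => a _.
by rewrite -scalemxAr clif_frame // scalemxAl.
Qed.

Definition triv_coord z xi y := triv S z y *m xi y.

Lemma triv_coord_clif z y u xi i : sdom S z y ->
  (triv S z y *m (clif S y u *m xi y)) i ord0 =
  \sum_a (eta S a * inner g y (frame S z y a) u)%:C *
    \sum_j sgamma S a i j * triv_coord z xi y j ord0.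
Proof.
move=> zy; rewrite mulmxA triv_clif // -mulmxA mulmx_suml summxE.
by apply: eq_bigr => a _; rewrite -scalemxAl !mxE.
Qed.

Lemma smooth_inner U X Y : open U -> vsmooth U X -> vsmooth U Y ->
  smooth U (fun y => inner g y (X y) (Y y)).
Proof. by move=> oU HX HY; apply: gram_smooth. Qed.

Lemma sdom_openI U z : open U -> open (U `&` sdom S z).
Proof. by move=> oU; apply: openI => //; apply: sdom_open. Qed.

Lemma frame_vsmooth U z a :
  vsmooth (U `&` sdom S z) (fun y => frame S z y a).
Proof.
move=> V f oV VU Hf; apply: (frame_smooth (s := S) (x := z) a oV) => // y /VU.
by case.
Qed.

Lemma vsmoothIl U W Y : vsmooth U Y -> vsmooth (U `&` W) Y.
Proof. by move=> HY; apply: vsmooth_sub HY => y []. Qed.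

Lemma frame_coord_smooth U z a Y : open U -> vsmooth U Y ->
  smooth (U `&` sdom S z) (fun y => eta S a * inner g y (frame S z y a) (Y y)).
Proof.
move=> oU HY; have oW := sdom_openI z oU.
apply: smooth_mul (smooth_cst _ _) _ => //; apply: smooth_inner => //.
  exact: frame_vsmooth.
exact: vsmoothIl.
Qed.

Lemma csmooth_mulmx U m (P : 'M[K]_(m, N)) (f : M -> 'cV[K]_N) i : open U ->
  (forall j, csmooth U (fun y => f y j ord0)) ->
  csmooth U (fun y => \sum_j P i j * f y j ord0).
Proof.
move=> oU H; apply: csmooth_sum => // j.
by apply: csmooth_mul => //; apply: csmooth_cst.
Qed.

Lemma ssmooth_clif U Y xi : open U -> vsmooth U Y -> ssmooth S U xi ->
  ssmooth S U (fun y => clif S y (Y y) *m xi y).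
Proof.
move=> oU HY Hxi z i; have oW := sdom_openI z oU.
apply: (csmooth_eq oW) => [y|].
  rewrite inE => -[_ zy]; rewrite triv_coord_clif //; exact: erefl.
apply: csmooth_sum => // a; apply: csmooth_mul => //.
  exact/csmooth_real/frame_coord_smooth.
by apply: csmooth_mulmx => // j; apply: Hxi.
Qed.

Lemma ssmooth_extend x (c : 'cV[K]_N) : exists2 xi,
  ssmooth S (sdom S x) xi & xi x = c.
Proof.
have xx := sdom_mem S x.
exists (fun y => invmx (triv S x y) *m (triv S x x *m c)); last first.
  by rewrite mulKmx // triv_unit.
move=> z i; have oW := sdom_openI z (@sdom_open _ _ _ _ S x).
apply: (csmooth_eq oW) => [y|].
  by rewrite inE => -[_ zy]; rewrite mulmxA mxE; exact: erefl.
apply: csmooth_sum => // j; apply: csmooth_mul (csmooth_cst _ _) => //.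
by rewrite setIC; apply: triv_smooth.
Qed.

Lemma vsmooth_extend x u : exists2 X, vsmooth (sdom S x) X & X x = u.
Proof.
pose c a := eta S a * inner g x (frame S x x a) u.
exists (fun y => \sum_a c a *: frame S x y a).
  by apply: vsmooth_sum => a; apply: frame_smooth.
by rewrite -(frame_expand (eta_sqr S) (frame_orth S x) u).
Qed.

Variable nab : M -> 'rV[R]_n -> (M -> 'rV[R]_n) -> 'rV[R]_n.
Hypothesis Hnab : is_levi_civita g nab.

Local Notation Om x v a b :=
  (inner g x (nab x v (fun y => frame S x y a)) (frame S x x b)).

Definition spin_form x v : 'M[K]_N := 4^-1 *: \sum_a \sum_b
  (eta S a * eta S b * Om x v a b)%:C *: (sgamma S a *m sgamma S b).

Definition dcol x v (f : M -> 'cV[K]_N) : 'cV[K]_N :=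
  \col_i cder x v (fun y => f y i ord0).

Lemma spin_nablaE x v xi : spin_nabla S nab x v xi =
  invmx (triv S x x) *m
    (dcol x v (triv_coord x xi) + spin_form x v *m triv_coord x xi x).
Proof.
congr (_ *m (_ + _)); rewrite -scalemxAl; congr (_ *: _).
rewrite mulmx_suml; apply: eq_bigr => a _; rewrite mulmx_suml.
by apply: eq_bigr => b _; rewrite -scalemxAl.
Qed.

(** Metric compatibility, applied to the constant inner products of the frame fields. *)
Lemma connection_form_anti x v a b : Om x v a b = - Om x v b a.
Proof.
have xx := sdom_mem S x; have oW := @sdom_open _ _ _ _ S x.
have := lc_metric Hnab v oW xx (frame_smooth (s := S) (x := x) a)
  (frame_smooth (s := S) (x := x) b).
rewrite (der_eq v oW xx (g := fun=> inner g x (frame S x x a) (frame S x x b))).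
  rewrite der_cst [inner g x (frame S x x a) _]inner_sym => /esym/eqP.
  by rewrite addr_eq0 => /eqP.
by move=> y; rewrite inE => xy; rewrite !frame_orthonormal.
Qed.

Lemma csmooth_triv_coord U x xi i : ssmooth S U xi ->
  csmooth (U `&` sdom S x) (fun y => triv_coord x xi y i ord0).
Proof. by move=> H; apply: H. Qed.

(** The product rule, with g(e_a, Y) differentiated by metric compatibility. The term containing the
    derivative of e_a is the one that [spin_form_commutator] removes later. *)
Lemma dcol_clif U x v Y xi : open U -> U x -> vsmooth U Y -> ssmooth S U xi ->
  dcol x v (triv_coord x (fun y => clif S y (Y y) *m xi y)) =
  sgamma_comb (fun a => eta S a * inner g x (frame S x x a) (Y x)) *m
    dcol x v (triv_coord x xi) +
  sgamma_comb (fun a => eta S a * (inner g x (nab x v (fun y => frame S x y a)) (Y x)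
    + inner g x (frame S x x a) (nab x v Y))) *m triv_coord x xi x.
Proof.
move=> oU Ux HY Hxi; have oW := sdom_openI x oU.
have Wx : (U `&` sdom S x) x by split=> //; apply: sdom_mem.
have Hphi j := csmooth_triv_coord x j Hxi.
have Hf a := csmooth_real (frame_coord_smooth x a oU HY).
apply/matrixP => i j; rewrite ord1 mxE [RHS]mxE !mulmx_suml !summxE -big_split /=.
rewrite (cder_eq v oW Wx (G := fun y => \sum_a
  (eta S a * inner g y (frame S x y a) (Y y))%:C *
    \sum_j sgamma S a i j * triv_coord x xi y j ord0)); last first.
  by move=> y; rewrite inE => -[_ zy]; rewrite triv_coord_clif.
have Hg a := csmooth_mulmx (sgamma S a) i oW Hphi.
rewrite (cder_sum Wx _ _ oW) => [|a]; last exact: csmooth_mul.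
apply: eq_bigr => a _; rewrite (cder_mul Wx _ oW (Hf a) (Hg a)) cder_real.
rewrite (cder_sum Wx _ _ oW) => [|k]; last first.
  by apply: csmooth_mul => //; apply: csmooth_cst.
rewrite -!scalemxAl 4!mxE; congr (_ * _ + _%:C * _).
- apply: eq_bigr => k _; rewrite (cder_mul Wx _ oW (csmooth_cst _ _) (Hphi k)).
  by rewrite cder_cst mul0r addr0 mxE.
- have Hi := smooth_inner oW (@frame_vsmooth U x a) (vsmoothIl HY).
  rewrite (der_mul Wx _ (smooth_cst _ (eta S a)) Hi) der_cst mulr0 addr0; congr (_ * _).
  exact: (lc_metric Hnab v oW Wx (@frame_vsmooth U x a) (vsmoothIl HY)).
Qed.

Lemma sgamma_combD c c' :
  sgamma_comb (fun a => c a + c' a) = sgamma_comb c + sgamma_comb c'.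
Proof.
by rewrite -big_split; apply: eq_bigr => a _; rewrite rmorphD scalerDl.
Qed.

Lemma eta_conj_sqr a : (eta S a)%:C * (eta S a)%:C = 1 :> K.
Proof. by rewrite -rmorphM eta_sqr. Qed.

Lemma spin_form_commutator x v u :
  spin_form x v *m sgamma_comb (fun a => eta S a * inner g x (frame S x x a) u) -
  sgamma_comb (fun a => eta S a * inner g x (frame S x x a) u) *m spin_form x v =
  - sgamma_comb (fun a => eta S a * inner g x (nab x v (fun y => frame S x y a)) u).
Proof.
pose q a : K := (eta S a)%:C; pose W a b : K := (Om x v a b)%:C.
have cliff a b : sgamma S a *m sgamma S b + sgamma S b *m sgamma S a =
    (if a == b then - (2 * q a) else 0)%:M.
  rewrite sgamma_clifford; case: eqP => // _; congr (_%:M).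
  by rewrite rmorphM rmorphMn rmorph1.
have W_anti a b : W a b = - W b a.
  by rewrite /W connection_form_anti rmorphN.
have K4 : (4 : K) != 0 by rewrite pnatr_eq0.
have := fun c => gam_connection_commutator cliff eta_conj_sqr K4 c W_anti.
set om := 4^-1 *: _ => Hom.
have -> : spin_form x v = om.
  congr (_ *: _); apply: eq_bigr => a _; apply: eq_bigr => b _.
  by rewrite !rmorphM.
rewrite /sgamma_comb mulmx_sumr mulmx_suml -sumrB.
under eq_bigr => c _ do rewrite -scalemxAr -scalemxAl -scalerBr Hom scaler_sumr.
rewrite exchange_big -sumrN; apply: eq_bigr => b _ /=.
rewrite (frame_expand (eta_sqr S) (frame_orth S x) u).
under eq_bigr do rewrite scalerA.
rewrite -scaler_suml -scaleNr; congr (_ *: _).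
rewrite [inner g x (nab _ _ _) _]inner_sym inner_suml mulr_sumr raddf_sum -sumrN.
apply: eq_bigr => c _; rewrite -(frame_expand (eta_sqr S) (frame_orth S x) u).
by rewrite /W connection_form_anti [inner g x (frame _ _ _ c) (nab _ _ _)]inner_sym
   !rmorphM rmorphN /q /=; ring.
Qed.

(** The frame derivative in [dcol_clif] cancels against the commutator of the connection form with
    Clifford multiplication; this is nabla gamma = 0. *)
Lemma spin_nabla_clif U x v Y xi : open U -> U x -> vsmooth U Y -> ssmooth S U xi ->
  spin_nabla S nab x v (fun y => clif S y (Y y) *m xi y) =
  clif S x (nab x v Y) *m xi x + clif S x (Y x) *m spin_nabla S nab x v xi.
Proof.
move=> oU Ux HY Hxi; have xx := sdom_mem S x; have Tu := triv_unit xx.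
rewrite !spin_nablaE (dcol_clif _ oU Ux HY Hxi) /triv_coord.
apply: (can_inj (mulKmx Tu)); rewrite mulKVmx // mulmxDr.
rewrite !(mulmxA (triv S x x)) !triv_clif // -!(mulmxA _ (triv S x x)) mulKVmx //.
move: (triv S x x *m xi x) (dcol _ _ _) => phi d.
rewrite mulmxDr.
have := spin_form_commutator x v (Y x); set G := sgamma_comb _.
have -> : sgamma_comb (fun a => eta S a *
   (inner g x (nab x v (fun y => frame S x y a)) (Y x) +
    inner g x (frame S x x a) (nab x v Y))) =
   sgamma_comb (fun a => eta S a * inner g x (nab x v (fun y => frame S x y a)) (Y x)) +
   sgamma_comb (fun a => eta S a * inner g x (frame S x x a) (nab x v Y)).
  by rewrite -sgamma_combD; apply: eq_bigr => a _; rewrite mulrDr.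
move: (sgamma_comb _) (sgamma_comb _) => P Q /eqP; rewrite subr_eq => /eqP E.
rewrite !mulmxA E !mulmxDl mulNmx -!addrA; set z := Q *m _.
by rewrite [P *m phi + (- z + _)]addrCA addNKr addrCA.
Qed.

Lemma spin_nabla_linear U x a u v xi : open U -> U x -> ssmooth S U xi ->
  spin_nabla S nab x (a *: u + v) xi =
  a%:C *: spin_nabla S nab x u xi + spin_nabla S nab x v xi.
Proof.
move=> oU Ux Hxi; have xx := sdom_mem S x.
have oW := sdom_openI x oU.
have Wx : (U `&` sdom S x) x by [].
rewrite !spin_nablaE scalemxAr -mulmxDr; congr (_ *m _).
rewrite scalerDr addrACA; congr (_ + _).
  rewrite /dcol; apply: linear_col => i.
  exact: (cder_linear Wx _ _ _ (csmooth_triv_coord x i Hxi)).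
rewrite scalemxAl -mulmxDl; congr (_ *m _).
rewrite /spin_form scalerA mulrC -scalerA -scalerDr; congr (_ *: _).
rewrite scaler_sumr -big_split; apply: eq_bigr => b _ /=.
rewrite scaler_sumr -big_split; apply: eq_bigr => c _ /=.
rewrite scalerA -scalerDl; congr (_ *: _).
rewrite (conn_linear (lc_conn Hnab) a u v (@sdom_open _ _ _ _ S x) xx
  (frame_smooth (s := S) (x := x) b)) inner_linearl mulrDr rmorphD; congr (_ + _).
by rewrite !rmorphM /=; ring.
Qed.

Variables (C : charge_conjugation S).
Variable D : M -> 'rV[R]_n -> (M -> 'cV[K]_N) -> 'cV[K]_N.
Hypothesis HD : spinor_connection S D.
Variable A : M -> 'rV[R]_n -> 'M[K]_N.
Hypothesis HA : is_difference S D (spin_nabla S nab) A.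

Lemma mulmx_cV_inj (P Q : 'M[K]_N) : (forall c : 'cV[K]_N, P *m c = Q *m c) -> P = Q.
Proof.
move=> H; apply/matrixP => i j; have := H (delta_mx j 0).
by rewrite -!colE => /matrixP/(_ i 0); rewrite !mxE.
Qed.

Lemma difference_linear x a u v : A x (a *: u + v) = a%:C *: A x u + A x v.
Proof.
apply: mulmx_cV_inj => c; have [xi Hxi <-] := ssmooth_extend x c.
have oW := @sdom_open _ _ _ _ S x; have xx := sdom_mem S x.
rewrite mulmxDl -scalemxAl -!(HA _ oW xx Hxi).
rewrite (conn_linear HD a u v oW xx Hxi) (spin_nabla_linear a u v oW xx Hxi).
by rewrite scalerBr opprD addrACA.
Qed.

Definition clif_defect x u v : 'M[K]_N :=
  A x u *m clif S x v + clif S x v *m charge_adj C x (A x u).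

(** All derivatives of [Y] and [xi] cancel by [spin_nabla_clif]. The minus sign in D^C = nabla - A^C
    produces the plus sign of [clif_defect]. *)
Lemma Dhat_gammaE U X Y xi x : open U -> vsmooth U Y -> ssmooth S U xi -> U x ->
  Dhat_gamma C nab D A X Y xi x = clif_defect x (X x) (Y x) *m xi x.
Proof.
move=> oU HY Hxi Ux; rewrite /Dhat_gamma /conj_connection /clif_defect.
have := HA (X x) oU Ux (ssmooth_clif oU HY Hxi); move/eqP; rewrite subr_eq => /eqP ->.
rewrite (spin_nabla_clif _ oU Ux HY Hxi); move: (spin_nabla _ _ _ _ _) => d.
rewrite mulmxBr mulmxDl !mulmxA; move: (clif _ _ (nab _ _ _) *m _) (_ *m d) => p q.
by rewrite opprB addrCA -[_ - p - q]addrA -opprD addrK addrC.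
Qed.

(** The expression is tensorial by [Dhat_gammaE], and every vector and spinor at [x] extends to a
    smooth local section. *)
Lemma admissibleP : admissible C nab D A <->
  forall x u v, clif_defect x u v = - clif_defect x v u.
Proof.
split=> [H x u v|H U X Y xi x oU HX HY Hxi Ux]; last first.
  by rewrite !(Dhat_gammaE _ oU _ Hxi Ux) // H mulNmx.
apply: mulmx_cV_inj => c; have [xi Hxi <-] := ssmooth_extend x c.
have [X HX <-] := vsmooth_extend x u; have [Y HY <-] := vsmooth_extend x v.
have oW := @sdom_open _ _ _ _ S x; have xx := sdom_mem S x.
have := H _ X Y xi x oW HX HY Hxi xx.
by rewrite !(Dhat_gammaE _ oW _ Hxi xx) // mulNmx.
Qed.
End SpinorBundle.

(** * Decomposition of A *)

Lemma altform_linear (R : realType) n (k : int) (a : R[i])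
    (w w' : seq 'rV[R]_n -> R[i]) :
  is_altform k w -> is_altform k w' -> is_altform k (fun s => a * w s + w' s).
Proof.
move=> Hw Hw'; split=> [s Hs|s1 s2 b u v|s Hs].
- by rewrite (alt_degree Hw) // (alt_degree Hw') // mulr0 addr0.
- by rewrite (alt_linear Hw) (alt_linear Hw'); ring.
- by rewrite (alt_alternating Hw) // (alt_alternating Hw') // mulr0 addr0.
Qed.

Section FormFields.
Local Open Scope classical_set_scope.
Variables (R : realType) (n : nat) (M : manifold R n) (g : metric M).
Variable S : spinor_bundle g.
Local Notation K := R[i].
Local Notation N := (2 ^ n./2)%N.
Local Notation V := 'rV[R]_n.
Implicit Types (U : set M) (X Y : M -> V) (x y z : M).

Lemma form_linear k U a (w w' : M -> seq V -> K) :
  is_form k U w -> is_form k U w' -> is_form k U (fun x s => a * w x s + w' x s).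
Proof.
move=> Hw Hw'; split=> [x Ux|W Xs oW WU HX].
  exact: altform_linear (form_alt Hw Ux) (form_alt Hw' Ux).
apply: csmooth_add (form_smooth Hw' oW WU HX) => //.
by apply: csmooth_mul (csmooth_cst _ _) (form_smooth Hw oW WU HX).
Qed.

Lemma form1_comb (k : nat) a (B B' : M -> V -> seq V -> K) :
  is_form1 k B -> is_form1 k B' -> is_form1 k (fun x v s => a * B x v s + B' x v s).
Proof.
move=> HB HB'; split=> [x b u v s|x v|U X oU HX].
- by rewrite (form1_linear HB) (form1_linear HB'); ring.
- exact: altform_linear (form1_alt HB x v) (form1_alt HB' x v).
- exact: form_linear (form1_smooth HB oU HX) (form1_smooth HB' oU HX).
Qed.

Lemma form1_contract (k : nat) F : is_form (k%:Z + 1) setT F ->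
  is_form1 k (fun x v => contract v (F x)).
Proof.
move=> HF; have Fa x := form_alt HF (I : setT x).
have Ca x v : is_altform k%:Z (contract v (F x)).
  by have := contract_altform v (Fa x); rewrite addrK.
split=> // [x a u v s|U X oU HX]; first exact: (alt_linear (Fa x) [::]).
split=> // W Xs oW WU HXs.
apply: (@form_smooth _ _ _ _ _ _ HF W (X :: Xs)) => // -[|i] Hi.
  exact: vsmooth_sub HX.
exact: HXs.
Qed.

Lemma nth_delete (T : Type) (d : T) (s : seq T) (i j : nat) : (i < size s)%N ->
  nth d (take i s ++ drop i.+1 s) j = nth d s (bump i j).
Proof.
move=> Hi; rewrite nth_cat size_takel ?(ltnW Hi) // /bump.
case: (ltnP j i) => ij; first by rewrite nth_take.
by rewrite nth_drop addSn subnKC.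
Qed.

Lemma vsmooth_delete U (Xs : seq (M -> V)) i : (i < size Xs)%N ->
    (forall j, (j < size Xs)%N -> vsmooth U (nth (fun=> 0) Xs j)) ->
  forall j, (j < size (take i Xs ++ drop i.+1 Xs))%N ->
    vsmooth U (nth (fun=> 0) (take i Xs ++ drop i.+1 Xs) j).
Proof.
move=> Hi HX j; rewrite size_cat size_takel ?(ltnW Hi) // size_drop => Hj.
rewrite nth_delete //; apply: HX; apply: (@leq_ltn_trans j.+1).
  by rewrite /bump -[j.+1]add1n leq_add2r leq_b1.
by move: Hj; rewrite -ltnS -addSn subnKC.
Qed.

Lemma nth_map_field (Xs : seq (M -> V)) x i :
  nth 0 [seq X x | X <- Xs] i = nth (fun=> 0) Xs i x.
Proof.
have [Hi|Hi] := ltnP i (size Xs); first by rewrite (nth_map (fun=> 0)).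
by rewrite !nth_default // size_map.
Qed.

Lemma form1_wedge (k : nat) G : is_form (k%:Z - 1) setT G ->
  is_form1 k (fun x v s => wedge g x v (G x) s).
Proof.
move=> HG; have Ga x := form_alt HG (I : setT x).
have Wa x v : is_altform k%:Z (fun s => wedge g x v (G x) s).
  by have := wedge_altform g x v (Ga x); rewrite subrK.
split=> // [x a u v s|U X oU HX]; first exact: wedge_linear.
split=> // W Xs oW WU HXs.
have H : csmooth W (fun x => \sum_(i < size Xs) (-1) ^+ i *
    (inner g x (X x) (nth (fun=> 0) Xs i x))%:C *
    G x [seq Y x | Y <- take i Xs ++ drop i.+1 Xs]).
  apply: csmooth_sum => // i; apply: csmooth_mul => //.
    apply: csmooth_mul (csmooth_cst _ _) _ => //; apply: csmooth_real.
    by apply: smooth_inner (vsmooth_sub WU HX) (HXs _ _).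
  by apply: (form_smooth HG) => //; apply: vsmooth_delete.
apply: (csmooth_eq oW) H => x _; rewrite /wedge size_map; apply: eq_bigr => i _.
by rewrite nth_map_field map_cat map_take map_drop.
Qed.

Lemma form_alternate (k : nat) B : is_form1 k B ->
  is_form (k%:Z + 1) setT (fun x => alternate (B x)).
Proof.
move=> HB; split=> [x _|W Xs oW _ HXs].
  by have := form1_alternate_altform HB x; rewrite intS addrC.
have H : csmooth W (fun x => \sum_(i < size Xs) (-1) ^+ i *
    B x (nth (fun=> 0) Xs i x) [seq Y x | Y <- take i Xs ++ drop i.+1 Xs]).
  apply: csmooth_sum => // i; apply: csmooth_mul (csmooth_cst _ _) _ => //.
  apply: (form_smooth (form1_smooth HB oW (HXs i (ltn_ord i)))) => //.
  exact: vsmooth_delete.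
apply: (csmooth_eq oW) H => x _; rewrite /alternate size_map.
by apply: eq_bigr => i _; rewrite nth_map_field map_cat map_take map_drop.
Qed.

Local Notation tr x := (trace1 (eta S) (frame S x x)).

(* The trace does not depend on the frame, and near each point it is computed in
   a frame that is smooth there. *)
Lemma form_trace (k : nat) B : is_form1 k B ->
  is_form (k%:Z - 1) setT (fun x => tr x (B x)).
Proof.
move=> HB; split=> [x _|W Xs oW _ HXs]; first exact: form1_trace_altform.
apply: csmooth_cover => z Wz; exists (W `&` sdom S z).
  by split=> //; apply: sdom_mem.
have oZ := sdom_openI S z oW.
have H : csmooth (W `&` sdom S z) (fun x => \sum_a (eta S a)%:C *
    B x (frame S z x a) [seq Y x | Y <- (fun y => frame S z y a) :: Xs]).
  apply: csmooth_sum => // a; apply: csmooth_mul (csmooth_cst _ _) _ => //.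
  have Ha := @frame_vsmooth _ _ _ _ S W z a.
  apply: (form_smooth (form1_smooth HB oZ Ha)) => // -[|i] //= Hi.
  exact: vsmoothIl (HXs i Hi).
apply: (csmooth_eq oZ) H => x; rewrite inE => -[_ zx].
rewrite (trace1_frame _ (eta_sqr S) (frame_orth S x)
  (fun a b => frame_orthonormal a b zx) (form1_alt HB x)) //.
exact: form1_linear HB x.
Qed.

Lemma form_scale k a w : is_form k setT w ->
  is_form k setT (fun (x : M) (s : seq V) => a * w x s).
Proof.
move=> Hw; split=> [x Ux|W Xs oW WU HX].
  (* The multiple a w is written as (a - 1) w + w, to match the shape of [altform_linear]. *)
  have H := altform_linear (a - 1) (form_alt Hw Ux) (form_alt Hw Ux).
  suff -> : (fun s => a * w x s) = (fun s => (a - 1) * w x s + w x s) by [].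
  by apply: funext => s; ring.
by apply: csmooth_mul (csmooth_cst _ _) (form_smooth Hw oW WU HX).
Qed.

Variables (l : nat) (A : M -> V -> 'M[K]_N).
Hypothesis Hln : (l <= n)%N.

Lemma form_endo_eq x w w' : is_altform l%:Z w -> is_altform l%:Z w' ->
  form_endo S x l w = form_endo S x l w' -> w = w'.
Proof.
move=> Hw Hw' E; apply: funext => s; apply/eqP; rewrite -subr_eq0 addrC -mulN1r.
apply/eqP; apply: (form_endo_inj (S := S) (x := x) (altform_linear (-1) Hw' Hw)).
by rewrite form_endo_linear E scaleN1r addNr.
Qed.

(** [homogeneous] gives a form for each local vector field rather than for each vector. A form is
    chosen for every point and vector through a local extension; by injectivity of [form_endo] it is
    unique, hence linear in the vector and equal to the smooth form of any field through it. *)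
Lemma homogeneous_form1 :
    (forall x a u v, A x (a *: u + v) = a%:C *: A x u + A x v) ->
    homogeneous S l A ->
  exists2 B, is_form1 l B & forall x v, A x v = form_endo S x l (B x v).
Proof.
move=> LA HA.
have /choice[f Hf] : forall p : M * V, exists w, is_altform l%:Z w /\
    A p.1 p.2 = form_endo S p.1 l w.
  move=> [x v] /=; have [X HX <-] := vsmooth_extend S x v.
  have [w Hw E] := HA _ X (@sdom_open _ _ _ _ S x) HX.
  exists (w x); have xx := sdom_mem S x.
  by split; [exact: (form_alt Hw xx) | apply: E].
exists (fun x v => f (x, v)) => [|x v]; last by have [] := Hf (x, v).
split=> [x a u v s|x v|U X oU HX].
- have [H1 E1] := Hf (x, u); have [H2 E2] := Hf (x, v).
  have [H3 E3] := Hf (x, a *: u + v); rewrite /= in E1 E2 E3.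
  have -> : f (x, a *: u + v) = (fun s => a%:C * f (x, u) s + f (x, v) s).
    apply: (form_endo_eq (x := x)) => //; first exact: altform_linear.
    by rewrite form_endo_linear -E1 -E2 -E3 LA.
  by [].
- by have [] := Hf (x, v).
have [w Hw E] := HA _ X oU HX.
have fw x : U x -> f (x, X x) = w x.
  move=> Ux; have [H1 E1] := Hf (x, X x); apply: (form_endo_eq (x := x)) => //.
    exact: (form_alt Hw Ux).
  by rewrite -E1 /= E.
split=> [x Ux|W Xs oW WU HXs]; first by have [] := Hf (x, X x).
apply: (csmooth_eq oW) (form_smooth Hw oW WU HXs) => x.
by rewrite inE => /WU Ux; rewrite fw.
Qed.

Lemma trace_coeff_neq0 : (n%:R - l%:R + 1 : K) != 0.
Proof. by rewrite -natrB // natr1 pnatr_eq0. Qed.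

Lemma altform_sizeE (k : nat) (w : seq V -> K) s : is_altform k%:Z w ->
  (size s)%:R * w s = k%:R * w s :> K.
Proof.
move=> Hw; have [->//|Hs] := eqVneq (size s) k.
rewrite (alt_degree Hw) ?mulr0 // => -[E]; by rewrite E eqxx in Hs.
Qed.

Lemma alternate_contractE (F : seq V -> K) s : is_altform (l%:Z + 1) F ->
  alternate (fun v => contract v F) s = l.+1%:R * F s.
Proof.
move=> HF; by rewrite (alternate_contract _ HF) (@altform_sizeE l.+1) // intS addrC.
Qed.

Lemma trace1_wedgeE x (G : seq V -> K) s : is_altform (l%:Z - 1) G ->
  tr x (fun v => wedge g x v G) s = (n%:R - l%:R + 1) * G s.
Proof.
move=> HG; rewrite (trace1_wedge (eta_sqr S) (frame_orth S x) _ HG).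
have [E|Hs] := eqVneq (size s).+1 l; first by rewrite -E -natr1; ring.
rewrite (alt_degree HG) ?mulr0 // => E; move/eqP: Hs; apply.
by apply/eqP; rewrite -eqz_nat intS E addrCA subrr addr0.
Qed.

Definition assembled (F G : M -> seq V -> K) (A0 : M -> V -> seq V -> K)
    x v s : K :=
  contract v (F x) s + wedge g x v (G x) s + A0 x v s.

Section Decomposition.
Variables (F G : M -> seq V -> K) (A0 : M -> V -> seq V -> K).
Hypotheses (HF : is_form (l%:Z + 1) setT F) (HG : is_form (l%:Z - 1) setT G).
Hypothesis (HA0 : is_form1 l A0).
Local Notation B := (assembled F G A0).

Lemma decomposition_form1 : is_form1 l B.
Proof.
have H := form1_comb 1 (form1_comb 1 (form1_contract HF) (form1_wedge HG)) HA0.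
suff -> : B = fun x v s =>
    1 * (1 * contract v (F x) s + wedge g x v (G x) s) + A0 x v s.
  exact: H.
apply: funext => x; apply: funext => v; apply: funext => s.
by rewrite !mul1r.
Qed.

Lemma decomposition_alternate x s :
  alternate (B x) s = l.+1%:R * F x s + alternate (A0 x) s.
Proof.
rewrite /assembled alternateD (alternateD (fun u => contract u (F x))).
rewrite (alternate_contractE _ (form_alt HF (I : setT x))) alternate_wedge.
by rewrite addr0.
Qed.

Lemma decomposition_trace x s :
  tr x (B x) s = (n%:R - l%:R + 1) * G x s + tr x (A0 x) s.
Proof.
rewrite /assembled trace1D (trace1D _ _ (fun u => contract u (F x))).
rewrite (trace1_contract _ _ _ (form_alt HF (I : setT x))) add0r.
by rewrite (trace1_wedgeE _ _ (form_alt HG (I : setT x))).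
Qed.

End Decomposition.

Lemma decomposition_exists :
    (forall x a u v, A x (a *: u + v) = a%:C *: A x u + A x v) ->
    homogeneous S l A ->
  exists F G A0, decomposes S l A F G A0.
Proof.
move=> LA HA; have [B HB EB] := homogeneous_form1 LA HA.
(* The scalars of [F] and [G] invert the factors in [decomposition_alternate] and
   [decomposition_trace]. The remainder [A0] then has neither alternation nor trace. *)
pose F x s := l.+1%:R^-1 * alternate (B x) s.
pose G x s := (n%:R - l%:R + 1)^-1 * tr x (B x) s.
have HF : is_form (l%:Z + 1) setT F := form_scale _ (form_alternate HB).
have HG : is_form (l%:Z - 1) setT G := form_scale _ (form_trace HB).
pose A0 x v s := -1 * (1 * contract v (F x) s + wedge g x v (G x) s) + B x v s.
have HA0 : is_form1 l A0.
  exact: form1_comb (form1_comb 1 (form1_contract HF) (form1_wedge HG)) HB.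
have BE : assembled F G A0 = B.
  apply: funext => x; apply: funext => v; apply: funext => s.
  by rewrite /assembled /A0 mulN1r mul1r addrA subrr add0r.
exists F, G, A0; split=> // [|x v]; last first.
  by rewrite EB -BE.
apply/(hookP S HA0); split=> x s.
  have := decomposition_alternate G A0 HF x s.
  rewrite BE /F mulrA mulfV ?pnatr_eq0 // mul1r.
  by move/eqP; rewrite eq_sym -subr_eq0 addrAC subrr add0r => /eqP.
have := decomposition_trace A0 HF HG x s.
rewrite BE /G mulrA mulfV ?trace_coeff_neq0 // mul1r.
by move/eqP; rewrite eq_sym -subr_eq0 addrAC subrr add0r => /eqP.
Qed.

End FormFields.

(** * Admissibility *)

Section Defect.
Variables (R : realType) (n : nat) (M : manifold R n) (g : metric M).
Variables (S : spinor_bundle g) (C : charge_conjugation S) (Delta : int -> int).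
Hypothesis HDelta : is_charge_signs C Delta.
Local Notation K := R[i].
Local Notation N := (2 ^ n./2)%N.
Local Notation V := 'rV[R]_n.
Variables (l : nat) (A : M -> V -> 'M[K]_N) (B : M -> V -> seq V -> K).
Hypotheses (Hln : (l <= n)%N) (HB : is_form1 l B).
Hypothesis EA : forall x v, A x v = form_endo S x l (B x v).

Lemma clif_defectE x u v : clif_defect C A x u v =
  (-1) ^+ l *: (form_endo S x l.+1 (wedge g x v (B x u)) +
                form_endo S x l.-1 (contract v (B x u))) +
  (Delta 0 * Delta l%:Z)%:~R *: (form_endo S x l.+1 (wedge g x v (B x u)) -
                form_endo S x l.-1 (contract v (B x u))).
Proof.
have Ba := form1_alt HB x u.
rewrite /clif_defect EA (charge_adj_form_endo HDelta) // -scalemxAr.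
by rewrite (form_endo_clif S x v Ba) (clif_form_endo S x v Ba).
Qed.

Lemma double_sign_neq0 : (2 * (-1) ^+ l : K) != 0.
Proof. by rewrite mulf_neq0 ?signr_eq0 // pnatr_eq0. Qed.

Lemma form_endoD x k (w w' : seq V -> K) :
  form_endo S x k w + form_endo S x k w' = form_endo S x k (fun s => w s + w' s).
Proof.
rewrite -[X in X + _]scale1r -form_endo_linear; congr (form_endo _ _ _ _).
by apply: funext => s; rewrite mul1r.
Qed.

Lemma altformDl k (w w' : seq V -> K) : is_altform k w -> is_altform k w' ->
  is_altform k (fun s => w s + w' s).
Proof.
move=> Hw Hw'; have := altform_linear 1 Hw Hw'.
suff -> : (fun s => 1 * w s + w' s) = (fun s => w s + w' s) by [].
by apply: funext => s; rewrite mul1r.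
Qed.

(** With this sign the contractions in [clif_defectE] cancel and the exterior products double, so
    injectivity in degree l + 1 applies. *)
Lemma clif_defect_wedge x u v : Delta 0 * Delta l%:Z = (-1) ^+ l ->
  clif_defect C A x u v = - clif_defect C A x v u <->
  forall s, wedge g x v (B x u) s + wedge g x u (B x v) s = 0.
Proof.
move=> HD.
have E y z : clif_defect C A x y z =
    (2 * (-1) ^+ l) *: form_endo S x l.+1 (wedge g x z (B x y)).
  rewrite clif_defectE HD rmorphXn rmorphN1 -scalerDr mulrC -scalerA.
  congr (_ *: _); move: (form_endo _ _ _ _) (form_endo _ _ _ _) => P Q.
  by rewrite addrACA subrr addr0 -mulr2n scaler_nat.
have Wa y z : is_altform l.+1%:Z (wedge g x z (B x y)).
  exact: wedge_altformS (form1_alt HB x y).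
rewrite !E; split=> [/eqP|H].
  rewrite -addr_eq0 -scalerDr scaler_eq0 (negbTE double_sign_neq0) /=.
  rewrite form_endoD => /eqP; apply: form_endo_inj; exact: altformDl.
apply/eqP; rewrite -addr_eq0 -scalerDr form_endoD.
rewrite (_ : (fun s => _) = fun=> 0) ?form_endo0 ?scaler0 //.
exact: funext.
Qed.

Lemma clif_defect_contract x u v : Delta 0 * Delta l%:Z = - (-1) ^+ l ->
  clif_defect C A x u v = - clif_defect C A x v u <->
  forall s, B x u (v :: s) + B x v (u :: s) = 0.
Proof.
move=> HD.
have E y z : clif_defect C A x y z =
    (2 * (-1) ^+ l) *: form_endo S x l.-1 (contract z (B x y)).
  rewrite clif_defectE HD rmorphN rmorphXn rmorphN1 scaleNr -scalerBr mulrC.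
  rewrite -scalerA.
  congr (_ *: _); move: (form_endo _ _ _ _) (form_endo _ _ _ _) => P Q.
  by rewrite opprB addrC addrA subrK -mulr2n scaler_nat.
rewrite !E; split=> [/eqP|H].
  rewrite -addr_eq0 -scalerDr scaler_eq0 (negbTE double_sign_neq0) /=.
  (* For l = 0 the index [l.-1] is not the degree of the contraction, which vanishes anyway because
     a 0-form is zero on non-empty lists. *)
  rewrite form_endoD => /eqP E0 s; case: (posnP l) => [l0|l_gt0].
    have B0 y : is_altform 0 (B x y) by have := form1_alt HB x y; rewrite l0.
    by rewrite !(alt_degree (B0 _)) // addr0.
  have Ca y z : is_altform l.-1%:Z (contract z (B x y)).
    by apply: contract_altformS; rewrite prednK //; apply: form1_alt HB x y.
  exact: (form_endo_inj (altformDl (Ca u v) (Ca v u)) E0).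
apply/eqP; rewrite -addr_eq0 -scalerDr form_endoD.
rewrite (_ : (fun s => _) = fun=> 0) ?form_endo0 ?scaler0 //.
exact: funext.
Qed.

End Defect.

Section AdmissibleDecomposition.
Variables (R : realType) (n : nat) (M : manifold R n) (g : metric M).
Variables (S : spinor_bundle g) (C : charge_conjugation S) (Delta : int -> int).
Hypothesis HDelta : is_charge_signs C Delta.
Local Notation K := R[i].
Local Notation N := (2 ^ n./2)%N.
Local Notation V := 'rV[R]_n.
Variables (l : nat) (A : M -> V -> 'M[K]_N).
Hypotheses (Hln : (l <= n)%N).
Variables (F G : M -> seq V -> K) (A0 : M -> V -> seq V -> K).
Hypothesis HFG : decomposes S l A F G A0.
Local Notation B := (assembled g F G A0).

Lemma sign_dichotomy :
  Delta 0 * Delta l%:Z = (-1) ^+ l \/ Delta 0 * Delta l%:Z = - (-1) ^+ l.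
Proof.
case: HDelta => s _ _; rewrite -signr_odd.
by case: (s 0) (s l%:Z) (odd l) => -> [] -> [] /=; auto.
Qed.

Lemma sign_contract :
  Delta 1 * Delta (l%:Z + 1) = -1 <-> Delta 0 * Delta l%:Z = - (-1) ^+ l.
Proof.
case: HDelta => s _ E; have [H _] := sign_condition s E (l%:Z + 1).
rewrite H addrK (_ : (-1) ^ (l%:Z + 1) = - (-1) ^+ l) //.
by rewrite addrC -intS -exprnP exprS mulN1r.
Qed.

(** Here deg - 1 = l - 2, and [Delta_sub2] contributes the sign that makes this condition the
    opposite of the one in [sign_contract]. *)
Lemma sign_wedge :
  Delta 1 * Delta (l%:Z - 1) = -1 <-> Delta 0 * Delta l%:Z = (-1) ^+ l.
Proof.
case: HDelta => s _ E; have [H _] := sign_condition s E (l%:Z - 1).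
rewrite H -addrA -opprD (Delta_sub2 s E) mulrN.
rewrite (_ : (-1) ^ (l%:Z - 1) = - (-1) ^+ l); last first.
  by rewrite exprzDr // mulrN1.
by split=> [/oppr_inj|->].
Qed.

(** The alternation and the trace of [B] recover [F] and [G], since those of [A0] vanish. In each
    sign case skewness expresses [B] through one of the two forms; then the other one and [A0] must
    vanish. *)
Lemma defect_skewP :
  (forall x u v, clif_defect C A x u v = - clif_defect C A x v u) <->
  [/\ forall x v s, A0 x v s = 0,
      (exists x s, F x s <> 0) -> Delta 1 * Delta (l%:Z + 1) = -1
    & (exists x s, G x s <> 0) -> Delta 1 * Delta (l%:Z - 1) = -1].
Proof.
have [HF HG Hhook EA] := HFG; have [HA0 _ _] := Hhook.
have [A0a A0t] := (hookP S HA0).1 Hhook.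
have HB : is_form1 l B := decomposition_form1 g HF HG HA0.
have LB x a u v t := form1_linear HB x a u v t.
have altB x s : alternate (B x) s = l.+1%:R * F x s.
  by rewrite (decomposition_alternate g G A0 HF) A0a addr0.
have trB x s : trace1 (eta S) (frame S x x) (B x) s = (n%:R - l%:R + 1) * G x s.
  by rewrite (decomposition_trace S A0 HF HG) A0t addr0.
have EA' x v : A x v = form_endo S x l (B x v) by rewrite EA.
have c0 := @trace_coeff_neq0 R n l Hln.
have s0 : (l.+1%:R : K) != 0 by rewrite pnatr_eq0.
have signE : (-1) ^+ l != - (-1) ^+ l :> int.
  by rewrite -addr_eq0 -mulr2n mulrn_eq0 signr_eq0.
rewrite (propext sign_contract) (propext sign_wedge).
case: sign_dichotomy => HD; rewrite HD.
- have -> : (forall x u v, clif_defect C A x u v = - clif_defect C A x v u) =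
      (forall x u v s, wedge g x v (B x u) s + wedge g x u (B x v) s = 0).
    apply: propext; have P := clif_defect_wedge HDelta Hln HB EA' _ _ _ HD.
    by split=> H x u v; apply/P.
  split=> [H|[A00 F0 _] x u v s].
    (* The trace of [B] is n - l + 1 times [G], and the same nonzero factor stands on the left of
       [wedge_symm_eq0]. *)
    have BE x v s : B x v s = wedge g x v (G x) s.
      have := wedge_symm_eq0 S (form1_alt HB x) (LB x)
        (fun u v s => H x v u s) v s.
      by rewrite (eq_wedge _ _ _ _ (trB x)) wedgeZ => /(mulfI c0).
    have F0 x s : F x s = 0.
      apply: (mulfI s0); rewrite -altB mulr0 -[RHS](alternate_wedge g x (G x) s).
      by apply: eq_alternate => u t; rewrite BE.
    split=> // [x v s|[x [s]]]; last by rewrite F0.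
    have := BE x v s; rewrite /assembled /contract F0 add0r => /eqP.
    by rewrite -subr_eq0 addrAC subrr add0r => /eqP.
  (* For this sign the condition attached to [F] is false, so [F] can have no non-zero value. *)
  have {}F0 y t : F y t = 0.
    have [//|/eqP Fy] := eqVneq (F y t) 0.
    by have /eqP := F0 (ex_intro _ y (ex_intro _ t Fy)); rewrite (negbTE signE).
  have BE y z t : B y z t = wedge g y z (G y) t.
    by rewrite /assembled A00 /contract F0 add0r addr0.
  rewrite (eq_wedge _ _ _ _ (BE x u)) (eq_wedge _ _ _ _ (BE x v)).
  by rewrite wedge_anticomm addNr.
have -> : (forall x u v, clif_defect C A x u v = - clif_defect C A x v u) =
    (forall x u v s, B x u (v :: s) + B x v (u :: s) = 0).
  apply: propext; have P := clif_defect_contract HDelta Hln HB EA' _ _ _ HD.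
  by split=> H x u v; apply/P.
split=> [H|[A00 _ G0] x u v s].
  have BE x v s : B x v s = contract v (F x) s.
    apply: (mulfI s0); rewrite -altB.
    apply: (contract_symm_eq0 (form1_alt HB x) (LB x)) => u' v' s'.
    by apply/eqP; rewrite -addr_eq0 H.
  (* The trace of [B] is a nonzero multiple of [G], and it vanishes because [B] is now a contraction
     of an alternating form. *)
  have G0 x s : G x s = 0.
    apply: (mulfI c0); rewrite -trB mulr0.
    rewrite -[RHS](trace1_contract (eta S) (frame S x x) s
      (form_alt HF (I : classical_sets.setT x))).
    by apply: eq_bigr => a _; rewrite BE.
  split=> // [x v s|[x [s]]]; last by rewrite G0.
  have := BE x v s; rewrite /assembled /wedge big1 => [|i _]; last first.
    by rewrite G0 mulr0.
  by rewrite addr0 => /eqP; rewrite -subr_eq0 addrAC subrr add0r => /eqP.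
have {}G0 y t : G y t = 0.
  have [//|/eqP Gy] := eqVneq (G y t) 0.
  have /eqP := G0 (ex_intro _ y (ex_intro _ t Gy)).
  by rewrite eq_sym (negbTE signE).
have BE y z t : B y z t = F y (z :: t).
  rewrite /assembled A00 addr0 /wedge big1 => [|i _]; first by rewrite addr0.
  by rewrite G0 mulr0.
by rewrite !BE (altform_swap _ _ _ (form_alt HF (I : classical_sets.setT x))) addNr.
Qed.

End AdmissibleDecomposition.

Local Close Scope complex_scope.

Theorem theorem2 (R : realType) (n : nat) (M : manifold R n) (g : metric M)
    (nab : M -> 'rV[R]_n -> (M -> 'rV[R]_n) -> 'rV[R]_n)
    (Hnab : is_levi_civita g nab)
    (S : spinor_bundle g)
    (C : charge_conjugation S) (Delta : int -> int)
    (HDelta : is_charge_signs C Delta)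
    (D : M -> 'rV[R]_n -> (M -> 'cV[R[i]]_(2 ^ n./2)) -> 'cV[R[i]]_(2 ^ n./2))
    (HD : spinor_connection S D)
    (A : M -> 'rV[R]_n -> 'M[R[i]]_(2 ^ n./2))
    (HA : is_difference S D (spin_nabla S nab) A)
    (l : nat) (Hl : (l <= if odd n then n./2 else n)%N)
    (Hhom : homogeneous S l A) :
  [/\ exists F G A0, decomposes S l A F G A0,
      forall F G A0, decomposes S l A F G A0 ->
        (admissible C nab D A <->
         [/\ forall x v s, A0 x v s = 0,
             (exists x s, F x s <> 0) -> Delta 1 * Delta (l%:Z + 1) = -1
           & (exists x s, G x s <> 0) -> Delta 1 * Delta (l%:Z - 1) = -1])
    & forall deg : int,
        (Delta 1 * Delta deg = -1 <->
         Delta 0 * Delta (deg - 1) = (-1) ^ deg) /\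
        (Delta 0 * Delta (deg - 1) = (-1) ^ deg <->
         (deg = 3 %[mod 4])%Z \/ (deg = 1 + Delta 0 * Delta 1 %[mod 4])%Z)].
Proof.
have Hln : (l <= n)%N.
  case: ifP Hl => // _ /leq_trans; apply.
  by rewrite leq_half_double -addnn -addSn leq_addl.
split.
- exact: decomposition_exists Hln (difference_linear Hnab HD HA) Hhom.
- move=> F G A0 HFG; rewrite (admissibleP Hnab C HA).
  exact: (defect_skewP HDelta Hln HFG).
- by case: HDelta => s _ E; apply: sign_condition.
Qed.
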